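(* Let $f$ be a positive integer and for non-negative integers $n_1,\dots,n_f$ put $N_i:=n_i+n_{i+1}+\dots+n_f$ for $i=1,\dots,f$. Then for $|q|<1$, \[ \sum_{m,n,n_1,\dots,n_f\geq 0}\frac{q^{2m^2+6mn+6n^2+m+3n+3(N_1^2+\dots+N_f^2+N_1+\dots+N_f)}(1+q^{1+2m+3n})(q^3;q^3)_{n_f}}{(q;q)_m(q^3;q^3)_n(q^3;q^3)_{n_f-2n-m}(q^3;q^3)_{n_1}\cdots(q^3;q^3)_{n_{f-1}}(q^3;q^3)_{2n_f+1}} =\frac{1}{(q^3;q^3)_\infty}\sum_{j=-\infty}^{\infty}q^{3(f+1)j^2+(3f+2)j}=\frac{(q^{6f+6},-q,-q^{6f+5};q^{6f+6})_\infty}{(q^3;q^3)_\infty}. \]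
   Context: $(a;p)_n=\prod_{k=0}^{n-1}(1-ap^k)$ for a base $p$, $(a_1,\dots,a_k;p)_n=(a_1;p)_n\cdots(a_k;p)_n$, and for $|p|<1$, $(a;p)_\infty=\lim_{n\to\infty}(a;p)_n$. By convention $1/(q^3;q^3)_n=0$ for negative integers $n$, so summands with $n_f-2n-m<0$ vanish. *)

(* Defs.v *)
From HB Require Import structures.
From mathcomp Require Import all_boot all_order all_algebra.
From mathcomp Require Import finmap.
From mathcomp Require Import all_classical all_reals topology normedtype.
From mathcomp Require Import summability complex.

Set Implicit Arguments.
Unset Strict Implicit.
Unset Printing Implicit Defensive.
Import Order.TTheory GRing.Theory Num.Theory.
Import numFieldNormedType.Exports.

Local Open Scope classical_set_scope.
Local Open Scope ring_scope.

Section Defs.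
Variable K : numFieldType.
Implicit Types a p q : K.

Definition qpoch a p (n : nat) : K := \prod_(k < n) (1 - a * p ^+ k).

(* Only meaningful for `|p| < 1, where the limit exists. *)
Definition qpoch_inf a p : K := lim (qpoch a p n @[n --> \oo]).

Definition qpochs_inf (s : seq K) p : K := \prod_(a <- s) qpoch_inf a p.

(* 1 / (a; p)_k, with the convention that it is 0 for k < 0. *)
Definition inv_qpoch a p (k : int) : K :=
  match k with
  | Posz n => (qpoch a p n)^-1
  | Negz _ => 0
  end.

(* Unconditional convergence: the net of the partial sums over the finite
   subsets of I, directed by inclusion, has a limit; [sum x] is that limit. *)
Definition uncond_cvg (I : choiceType) (x : I -> K) : Prop :=
  cvg (partial_sum x @ totally).

(* Tuples are indexed from 0: n_{i+1} is [nth 0 n i], and N_{i+1} is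
   [tailsum n i]. *)
Definition tailsum (f : nat) (n : f.-tuple nat) (i : nat) : nat :=
  (\sum_(i <= k < f) nth 0 n k)%N.

Definition multisum_exponent (f m n : nat) (ns : f.-tuple nat) : nat :=
  (2 * m ^ 2 + 6 * m * n + 6 * n ^ 2 + m + 3 * n
   + 3 * (\sum_(i < f) tailsum ns i ^ 2 + \sum_(i < f) tailsum ns i))%N.

Definition multisum_term (f : nat) q (t : nat * nat * f.-tuple nat) : K :=
  let: (m, n, ns) := t in
  let nf := nth 0%N ns f.-1 in
  q ^+ multisum_exponent m n ns * (1 + q ^+ (1 + 2 * m + 3 * n)%N)
  * qpoch (q ^+ 3) (q ^+ 3) nf
  / (qpoch q q m * qpoch (q ^+ 3) (q ^+ 3) n)
  * inv_qpoch (q ^+ 3) (q ^+ 3) (nf%:Z - 2%:Z * n%:Z - m%:Z)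
  / (\prod_(i < f.-1) qpoch (q ^+ 3) (q ^+ 3) (nth 0%N ns i)
     * qpoch (q ^+ 3) (q ^+ 3) (2 * nf + 1)%N).

(* The exponent is >= 0 for all j : int, so q = 0 is harmless. *)
Definition theta_term (f : nat) q (j : int) : K :=
  q ^ (3%:Z * (f%:Z + 1) * j ^+ 2 + (3%:Z * f%:Z + 2%:Z) * j).

End Defs.

(* Main.v *)
Require Import Defs.
From mathcomp Require Import all_boot all_order all_algebra.
From mathcomp Require Import finmap.
From mathcomp Require Import all_classical all_reals topology normedtype.
From mathcomp Require Import sequences exp.
From mathcomp Require Import summability complex.
From mathcomp Require Import zify ring lra.
Import Order.TTheory GRing.Theory Num.Theory.
Import numFieldNormedType.Exports.

Set Implicit Arguments.
Unset Strict Implicit.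
Unset Printing Implicit Defensive.

Local Open Scope classical_set_scope.
Local Open Scope ring_scope.

(**
  Put p = q^3.  The m,n-sum at fixed N = n_f is the beta-side of a Bailey pair
  relative to a = p in base p, with alpha-side q^(3 j^2 + 2 j):

    (p;p)_N * sum_(m,n) ... = sum_j q^(3 j^2 + 2 j) [2 N + 1, N - j]_p.

  With s = m + 2 n the exponent of q is 3 s (s + 1) / 2 + m (m - 1) / 2.  The
  factorisation (-z; q)_oo = (-z, -z q, -z q^2; q^3)_oo, read off coefficientwise,
  splits q^(m (m - 1) / 2) / (q; q)_m into three base-p factors; the Durfee
  rectangle identity then absorbs the sum over n.  A reflection of the summand
  carrying q^(1 + 2 m + 3 n) merges it with the other one, and two applications
  of the q-Vandermonde sum finish.  The Durfee identity is also the Bailey step,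
  so iterating it f times gives an identity between finite sums, truncated by
  1 / (p; p)_(M - N_1).  Letting M tend to infinity by dominated convergence yields
  the first equality, and the same limit in the finite Jacobi triple product
  yields the second.
*)

(** * Gaussian binomials *)

Section OrdinalSums.
Variable V : nmodType.
Implicit Type F : nat -> V.

Lemma sum_ord_widen B C F : (B <= C)%N ->
  (forall n, (B <= n)%N -> F n = 0) -> \sum_(n < C) F n = \sum_(n < B) F n.
Proof.
move=> BC F0; rewrite -!(big_mkord xpredT F) (big_cat_nat (n := B)) //=.
rewrite [X in _ + X]big_nat [X in _ + X]big1 ?addr0 // => i /andP[Bi _]; exact: F0.
Qed.

Lemma sum_ord_shift B n F : (forall a, (B <= a + n)%N -> F a = 0) ->
  \sum_(a < B) F a = \sum_(k < B | (n <= k)%N) F (k - n)%N.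
Proof.
move=> F0; rewrite -!(big_mkord xpredT F) -(big_mkord (fun k => (n <= k)%N) (fun k => F (k -
    n)%N)).
have [nB|Bn] := leqP n B; last first.
  rewrite big_mkord [RHS]big_nat_cond !big1 // => [i /andP[/andP[_ ? ]]|i _]; [lia|apply: F0;
      lia].
rewrite [RHS](big_cat_nat (n := n)) //= [X in X + _]big_nat_cond [X in X + _]big1; last first.
  by move=> i; lia.
rewrite add0r (_ : (\sum_(n <= k < B | (n <= k)%N) F (k - n)%N) = \sum_(0 + n <= k < B | (n <=
    k)%N) F (k - n)%N) //.
rewrite [RHS]big_addn [LHS](big_cat_nat (n := (B - n)%N)) //=; last lia.
rewrite [X in _ + X]big_nat_cond [X in _ + X]big1 ?addr0; last first.
  by move=> i ?; apply: F0; lia.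
rewrite [RHS]big_mkcond; apply: eq_bigr => i _.
by rewrite leq_addl addnK.
Qed.

Lemma sum_ord_le A n F : (forall i, (A <= i)%N -> F i = 0) ->
  \sum_(i < A | (i <= n)%N) F i = \sum_(i < n.+1) F i.
Proof.
move=> F0; rewrite big_mkcond /=.
set H := fun i => if (i <= n)%N then F i else 0.
transitivity (\sum_(i < A + n.+1) H i).
  by apply/esym/sum_ord_widen => [|i Ai]; [lia|rewrite /H F0 // if_same].
rewrite (@sum_ord_widen n.+1) => [||i ni]; last by rewrite /H leqNgt ni.
  by apply: eq_bigr => i _; rewrite /H -ltnS ltn_ord.
lia.
Qed.

Lemma sum_ordS B F : F 0%N = 0 -> F B = 0 -> \sum_(i < B) F i.+1 = \sum_(i < B) F i.
Proof.
move=> F0 FB; transitivity (\sum_(i < B.+1) F i).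
  by rewrite big_ord_recl F0 add0r.
by rewrite big_ord_recr /= FB addr0.
Qed.

(** The substitution [k = a + n], [i = b + n] moves [n] to the innermost sum, where the Durfee
    identity can act on it. *)
Lemma sum_ord_shift2 B (F : nat -> nat -> nat -> V) :
  (forall n a b, (B <= a + n)%N || (B <= b + n)%N -> F n a b = 0) ->
  \sum_(n < B) \sum_(a < B) \sum_(b < B) F n a b =
  \sum_(k < B) \sum_(i < B) \sum_(n < B | (n <= k)%N && (n <= i)%N) F n (k - n)%N (i - n)%N.
Proof.
move=> F0.
transitivity (\sum_(n < B) \sum_(k < B | (n <= k)%N) \sum_(i < B | (n <= i)%N) F n (k - n)%N (i
    - n)%N).
  apply: eq_bigr => n _.
  rewrite (@sum_ord_shift B n (fun a => \sum_(b < B) F n a b)); last first.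
    by move=> a Ba; rewrite big1 // => b _; rewrite F0 ?Ba.
  apply: eq_bigr => k _; rewrite (@sum_ord_shift B n) // => b Bb.
  by rewrite F0 ?Bb ?orbT.
rewrite (exchange_big_dep xpredT) //=; apply: eq_bigr => k _.
by rewrite (exchange_big_dep xpredT).
Qed.

End OrdinalSums.

Lemma bin2_sqr n : (2 * 'C(n, 2) + n = n * n)%N.
Proof. by elim: n => // n IH; rewrite binS bin1; lia. Qed.

(** The q-Pascal recursion involves no division: the Gaussian binomial is a polynomial in [p], and
    it vanishes for [k > n]. *)
Fixpoint gbin (K : nzRingType) (p : K) (n k : nat) : K :=
  match n, k with
  | _, 0 => 1
  | 0, _.+1 => 0
  | n'.+1, k'.+1 => gbin p n' k' + p ^+ k'.+1 * gbin p n' k'.+1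
  end.

Section GaussianBinomial.
Variables (K : numFieldType) (p : K).
Local Notation P := (qpoch p p).
Local Notation G := (gbin p).
Implicit Types (g : nat -> K).

Lemma qpochS a n : qpoch a p n.+1 = qpoch a p n * (1 - a * p ^+ n).
Proof. by rewrite /qpoch big_ord_recr. Qed.

Lemma qpoch0 a : qpoch a p 0 = 1.
Proof. by rewrite /qpoch big_ord0. Qed.

Lemma qpochSn n : P n.+1 = P n * (1 - p ^+ n.+1).
Proof. by rewrite qpochS exprS. Qed.

Lemma gbin0 n : G n 0 = 1.
Proof. by case: n. Qed.

Lemma gbinS n k : G n.+1 k.+1 = G n k + p ^+ k.+1 * G n k.+1.
Proof. by []. Qed.

Lemma gbin_small n k : (n < k)%N -> G n k = 0.
Proof.
elim: n k => [|n IH] [|k] //= nk.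
by rewrite !IH ?mulr0 ?addr0 //; lia.
Qed.

Lemma gbinn n : G n n = 1.
Proof. by elim: n => //= n ->; rewrite gbin_small // mulr0 addr0. Qed.

Lemma gbin_qpoch n k : (k <= n)%N -> G n k * P k * P (n - k) = P n.
Proof.
elim: n k => [|n IH] [|k] //= kn; rewrite ?qpoch0 ?mulr1 ?mul1r ?subn0 //.
rewrite subSS.
have [kn'|nk] := ltnP k n; last first.
  have -> : k = n by lia.
  by rewrite gbinn gbin_small // subnn qpoch0 mulr0 addr0 mul1r mulr1.
have e : (n - k)%N = (n - k.+1).+1 by lia.
rewrite (qpochSn n) mulrDl mulrDl.
have /esym E1 := IH k (ltnW kn'); have /esym E2 := IH k.+1 kn'.
have -> : p ^+ k.+1 * G n k.+1 * P k.+1 * P (n - k) = p ^+ k.+1 * (1 - p ^+ (n - k)) * P n.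
  by rewrite E2 e (qpochSn (n - k.+1)); ring.
have -> : G n k * P k.+1 * P (n - k) = (1 - p ^+ k.+1) * P n.
  by rewrite E1 qpochSn; ring.
have -> : p ^+ n.+1 = p ^+ k.+1 * p ^+ (n - k) by rewrite -exprD; congr (_ ^+ _); lia.
ring.
Qed.

(** The sum side of q-Vandermonde with an arbitrary [g] as second factor: [g = gbin p B] gives
    q-Vandermonde, and [g = 1 / (p; p)] gives the Durfee rectangle identity. The truncated [A - i]
    is harmless, since [G A i = 0] for [i > A]. *)
Definition gconv A n g : K :=
  \sum_(i < n.+1) p ^+ ((A - i) * (n - i)) * G A i * g (n - i)%N.

Lemma gconv0 n g : gconv 0 n g = g n.
Proof.
rewrite /gconv big_ord_recl [X in _ + X]big1 => [|i _]; last by rewrite /= mulr0 mul0r.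
by rewrite /= sub0n mul0n subn0 expr0 !mul1r addr0.
Qed.

Lemma gconvn0 A g : gconv A 0 g = g 0%N.
Proof. by rewrite /gconv big_ord1 gbin0 subn0 muln0 expr0 !mul1r. Qed.

(** Applying q-Pascal to [G A.+1 i] yields the very recursion that defines [gbin], whatever [g]
    is. *)
Lemma gconvS A n g : gconv A.+1 n.+1 g = gconv A n g + p ^+ n.+1 * gconv A n.+1 g.
Proof.
rewrite /gconv big_ord_recl [in X in _ = _ + _ * X]big_ord_recl /= !gbin0 !subn0.
rewrite mulrDr addrCA; congr (_ + _).
  by rewrite !mulr1 mulrA -exprD; congr (_ ^+ _ * _); lia.
rewrite mulr_sumr -big_split; apply: eq_bigr => i _ /=.
rewrite !/bump /= !add1n !subSS -gbinS gbinS mulrDr mulrDl; congr (_ + _).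
have [Ai|iA] := ltnP A i.+1; first by rewrite gbin_small // !(mulr0, mul0r).
rewrite !mulrA -!exprD; congr (_ ^+ _ * _ * _).
case: i iA => i iN /= iA.
have [c ->] : exists c, A = (c + i.+1)%N by exists (A - i.+1)%N; lia.
have [d ->] : exists d, n = (d + i)%N by exists (n - i)%N; lia.
have -> : (c + i.+1 - i = c.+1)%N by lia.
have -> : (c + i.+1 - i.+1 = c)%N by lia.
have -> : (d + i - i = d)%N by lia.
lia.
Qed.

Lemma gbin_Vandermonde A B n : gconv A n (G B) = G (A + B) n.
Proof.
elim: A n => [|A IH] [|n]; rewrite ?gconv0 ?gconvn0 ?gbin0 //.
by rewrite gconvS !IH.
Qed.

Hypothesis P0 : forall n, P n != 0.

(** The sequence [1 / (p; p)_n] is a fixed point of the recursion [gconvS], hence unchanged by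
    induction on [A]. *)
Lemma gconv_inv A n : gconv A n (fun k => (P k)^-1) = (P n)^-1.
Proof.
elim: A n => [|A IH] [|n]; rewrite ?gconv0 ?gconvn0 //.
rewrite gconvS !IH qpochSn; have := P0 n.+1; rewrite qpochSn => h.
have := P0 n => h'; have h2 : 1 - p ^+ n.+1 != 0 by apply: contraNneq h => ->; rewrite mulr0.
by field; rewrite h2.
Qed.

Lemma gbinE n k : (k <= n)%N -> G n k = P n / (P k * P (n - k)).
Proof. by move=> kn; rewrite -(gbin_qpoch kn); field; rewrite !P0. Qed.

Lemma gbin_sym n k : (k <= n)%N -> G n (n - k) = G n k.
Proof. by move=> kn; rewrite !gbinE ?leq_subr // subKn // [X in _ / X]mulrC. Qed.

Lemma gbinS_left n k : (k <= n)%N -> G n.+1 k.+1 = p ^+ (n - k) * G n k + G n k.+1.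
Proof.
move=> kn; rewrite -gbin_sym // subSS.
have [kn'|nk] := ltnP k n; last first.
  have -> : k = n by lia.
  rewrite subnn !gbin0 [G n n.+1]gbin_small // expr0 mul1r addr0.
  by rewrite -gbin_sym // subnn gbin0.
have -> : (n - k)%N = (n - k.+1).+1 by lia.
rewrite gbinS gbin_sym // addrC; congr (_ * _ + _).
by have -> : (n - k.+1).+1 = (n - k)%N by [lia]; rewrite gbin_sym // ltnW.
Qed.

Lemma gbinS_compl n k : (k <= n)%N ->
  (1 - p ^+ (n.+1 - k)) * G n.+1 k = (1 - p ^+ n.+1) * G n k.
Proof.
move=> kn; rewrite !gbinE ?(leqW kn) // qpochSn.
have e : (n.+1 - k = (n - k).+1)%N by lia.
rewrite e qpochSn.
have := P0 (n - k).+1; rewrite qpochSn mulf_eq0 negb_or => /andP[h1 h2].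
by field; rewrite h2 !P0.
Qed.

(* 1 / (p; p)_(a - b), which is 0 for a < b. *)
Definition invP a b : K := if (b <= a)%N then (P (a - b))^-1 else 0.

Lemma invP_small a b : (a < b)%N -> invP a b = 0.
Proof. by rewrite /invP ltnNge => /negbTE ->. Qed.

Lemma invPE a b : (b <= a)%N -> invP a b = (P (a - b))^-1.
Proof. by rewrite /invP => ->. Qed.

Lemma gbin_invP n k : G n k = P n * ((P k)^-1 * invP n k).
Proof.
have [nk|kn] := ltnP n k; first by rewrite gbin_small // invP_small // !mulr0.
by rewrite gbinE // invPE // invfM.
Qed.

(** This is [gconv_inv] divided by [P i]. Terms with [n > k] vanish, so any box of size [B > k] may
    carry the sum. *)
Lemma durfee B i k : (k < B)%N ->
  \sum_(n < B) p ^+ ((k - n) * (i - n)) * (invP k n * invP i n * (P n)^-1)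
  = (P k)^-1 * (P i)^-1.
Proof.
move=> kB.
rewrite (@sum_ord_widen _ k.+1 B (fun n => p ^+ ((k - n) * (i - n)) * (invP k n * invP i n * (P
    n)^-1))) //; last first.
  by move=> n kn; rewrite invP_small // !(mul0r, mulr0).
rewrite -(gconv_inv i k) /gconv mulr_suml; apply: eq_bigr => n _.
rewrite gbin_invP (invPE (a := k)); last by rewrite -ltnS ltn_ord.
by rewrite mulnC; move: (P0 i) => ?; field; rewrite !P0.
Qed.

(** The weight [H] sees only [k = a + n] and [i = b + n], so for fixed [k] and [i] the sum over [n]
    is exactly [durfee]. *)
Lemma durfee_sum B (H : nat -> nat -> K) :
  (forall k i, (B <= k)%N || (B <= i)%N -> H k i = 0) ->
  \sum_(n < B) \sum_(a < B) \sum_(b < B)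
     H (a + n)%N (b + n)%N * p ^+ (a * b) * ((P a)^-1 * (P b)^-1 * (P n)^-1)
  = \sum_(k < B) \sum_(i < B) H k i * ((P k)^-1 * (P i)^-1).
Proof.
move=> H0.
rewrite (@sum_ord_shift2 _ B (fun n a b => H (a + n)%N (b + n)%N * p ^+ (a * b) *
  ((P a)^-1 * (P b)^-1 * (P n)^-1))); last by move=> n a b ab; rewrite H0 // !mul0r.
apply: eq_bigr => k _; apply: eq_bigr => i _.
rewrite -(durfee i (ltn_ord k)) mulr_sumr big_mkcond; apply: eq_bigr => n _.
case: (leqP n k) => nk /=; last by rewrite (invP_small nk) !(mul0r, mulr0).
case: (leqP n i) => ni /=; last by rewrite (invP_small ni) !(mul0r, mulr0).
by rewrite !subnK // !invPE // !mulrA.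
Qed.

End GaussianBinomial.

Arguments gbin : simpl never.

(** * The Bailey pair of the Capparelli sum *)

Section Trisection.
Variables (K : numFieldType) (q : K).
Local Notation p := (q ^+ 3).
Local Notation P := (qpoch p p).
Hypothesis P0 : forall n, P n != 0.
Hypothesis Q0 : forall n, qpoch q q n != 0.

(** By Euler, the coefficient of [z^n] in [(-z; x)_oo]. *)
Definition euler_coef (x : K) n : K := x ^+ 'C(n, 2) / qpoch x x n.

Local Notation e := (euler_coef p).

Lemma euler_coefS (x : K) n : qpoch x x n.+1 != 0 ->
  (1 - x ^+ n.+1) * euler_coef x n.+1 = x ^+ n * euler_coef x n.
Proof.
rewrite /euler_coef qpochSn binS bin1 exprD mulf_eq0 negb_or => /andP[h1 h2].
by field; rewrite ?h1 ?h2.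
Qed.

(** The coefficient of [z^m] in [(-z q^2, -z q, -z; q^3)_oo], the indices [a], [b], [r] belonging to
    the factors in this order, each cut off at [B]. *)
Definition trisection_coef B m : K :=
  \sum_(a < B) \sum_(b < B) \sum_(r < B)
     (a + b + r == m)%N%:R * (q ^+ (2 * a + b) * (e a * e b * e r)).

(* Multiplying z by q permutes the three factors cyclically, up to the first being
   shifted from z to z q^3. *)
Lemma trisection_coef_cycle B m :
  q ^+ m * trisection_coef B m =
  \sum_(a < B) \sum_(b < B) \sum_(r < B)
     (a + b + r == m)%N%:R * (q ^+ (2 * a + b) * (e a * e b * (p ^+ r * e r))).
Proof.
rewrite /trisection_coef exchange_big mulr_sumr.
under [RHS]eq_bigr => a _ do rewrite exchange_big.
rewrite [RHS]exchange_big.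
transitivity (\sum_(b < B) \sum_(a < B) \sum_(r < B)
    (a + b + r == m)%N%:R * (q ^+ (2 * b + r) * (e b * e r * (p ^+ a * e a)))).
  apply: eq_bigr => b _; rewrite mulr_sumr; apply: eq_bigr => a _.
  rewrite mulr_sumr; apply: eq_bigr => r _.
  have [<-|_] := eqVneq; last by rewrite !mul0r mulr0.
  rewrite !mul1r -exprM mulrA -exprD.
  have -> : (a + b + r + (2 * a + b) = 2 * b + r + 3 * a)%N by lia.
  by rewrite exprD; ring.
rewrite [RHS]exchange_big; apply: eq_bigr => b _.
rewrite exchange_big [RHS]exchange_big; apply: eq_bigr => r _ /=.
apply: eq_bigr => a _; congr (_%:R * _); lia.
Qed.


(** Both sides equal 1 at [m = 0] and satisfy [(1 - q^(m+1)) c_(m+1) = q^m c_m]. On the trisected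
    side, the cyclic rule turns the left factor into [1 - p^r] on the index [r], and [euler_coefS]
    then lowers [r] by one. *)
Lemma trisection_coefE B m : (m < B)%N -> trisection_coef B m = euler_coef q m.
Proof.
elim: m => [|m IH] mB.
  case: B mB => // B _; rewrite /trisection_coef.
  rewrite big_ord_recl [X in _ + X]big1; last first.
    by move=> a _; rewrite big1 // => b _; rewrite big1 // => r _; rewrite /= mul0r.
  rewrite big_ord_recl [X in _ + X + _]big1; last first.
    by move=> b _; rewrite big1 // => r _; rewrite /= mul0r.
  rewrite big_ord_recl [X in _ + X + _ + _]big1; last first.
    by move=> r _; rewrite /= mul0r.
  by rewrite /euler_coef /= !qpoch0 !expr0 !divr1 !mulr1 !addr0.
have h := Q0 m.+1.
have hm : 1 - q ^+ m.+1 != 0.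
  by move: h; rewrite qpochSn mulf_eq0 negb_or => /andP[].
apply: (mulfI hm); rewrite euler_coefS // -IH; last lia.
rewrite mulrBl mul1r !trisection_coef_cycle /trisection_coef -sumrB.
apply: eq_bigr => a _; rewrite -sumrB; apply: eq_bigr => b _; rewrite -sumrB.
case: B {IH} mB a b => // B mB a b.
(* The term [r = 0] dies because [1 - p^0 = 0], and the top term [r = B] cannot occur in degree
   [m < B]. *)
rewrite big_ord_recl [in RHS]big_ord_recr /=.
have -> : (a + b + B == m)%N = (a + b + B == m)%N && (B == m) by lia.
have [eB|_] := eqVneq B m; first by lia.
rewrite andbF mul0r addr0 !expr0 !mul1r subrr add0r.
apply: eq_bigr => r _; rewrite /bump /= add1n.
have -> : (a + b + r.+1 == m.+1)%N = (a + b + r == m)%N by lia.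
by rewrite -(@euler_coefS _ r) //; ring.
Qed.

Lemma trisection_sum B (g : nat -> K) : (forall m, (B <= m)%N -> g m = 0) ->
  \sum_(m < B) g m * euler_coef q m =
  \sum_(a < B) \sum_(b < B) \sum_(r < B)
    g (a + b + r)%N * (q ^+ (2 * a + b) * (e a * e b * e r)).
Proof.
move=> g0.
under eq_bigr => m _ do rewrite -(trisection_coefE (ltn_ord m)) /trisection_coef mulr_sumr.
rewrite exchange_big; apply: eq_bigr => a _.
under eq_bigr => m _ do rewrite mulr_sumr.
rewrite exchange_big; apply: eq_bigr => b _.
under eq_bigr => m _ do rewrite mulr_sumr.
rewrite exchange_big; apply: eq_bigr => r _.
under eq_bigr => m _ do rewrite mulrA.
rewrite -mulr_suml; congr (_ * _).
have [Bs|sB] := leqP B (a + b + r)%N.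
  rewrite g0 // big1 // => m _; case: eqVneq => [E|_]; last by rewrite mulr0.
  by move: (ltn_ord m); lia.
rewrite (bigD1 (Ordinal sB)) //= eqxx mulr1 big1 ?addr0 // => m.
rewrite -val_eqE /= eq_sym => /negbTE ->; exact: mulr0.
Qed.

End Trisection.

(* The exponent is >= 0, so the absolute value only turns it into a natural number. *)
Definition theta_exp (f : nat) (j : int) : nat :=
  absz (3%:Z * (f%:Z + 1) * j ^+ 2 + (3%:Z * f%:Z + 2%:Z) * j).

Lemma theta_expE f j :
  (theta_exp f j)%:Z = 3%:Z * (f%:Z + 1) * (j * j) + (3%:Z * f%:Z + 2%:Z) * j.
Proof.
rewrite /theta_exp expr2 gez0_abs //.
(* The quadratic is negative only between its roots 0 and [-(3f+2)/(3f+3)], an interval containing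
   no integer. *)
have [] : 0 <= j \/ j <= -1 by lia.
all: nia.
Qed.

Section CapparelliSum.
Variables (K : numFieldType) (q : K).
Local Notation p := (q ^+ 3).
Local Notation P := (qpoch p p).
Local Notation I := (invP p).
Local Notation e := (euler_coef p).
Hypothesis P0 : forall n, P n != 0.
Hypothesis Q0 : forall n, qpoch q q n != 0.

(** The part of the multisum term that involves [m] and [n], at [n_f = N]; the factor
    [P N / P (2 * N).+1] is kept apart. *)
Definition capparelli_term N m n : K :=
  q ^+ (2 * m ^ 2 + 6 * m * n + 6 * n ^ 2 + m + 3 * n) * (1 + q ^+ (1 + 2 * m + 3 * n))
  / (qpoch q q m * P n) * I N (m + 2 * n).

Definition capparelli_form i k r : nat := (i * i + k * k + r * r + r * (i + k))%N.

Let g1 N n m : K := q ^+ (3 * 'C((m + 2 * n).+1, 2)) * I N (m + 2 * n) / P n.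
Let g2 N n m : K := q ^+ (1 + 2 * m + 3 * n) * g1 N n m.

Lemma capparelli_termE N m n :
  capparelli_term N m n = g1 N n m * euler_coef q m + g2 N n m * euler_coef q m.
Proof.
rewrite /g2 /g1 /euler_coef /capparelli_term.
have -> : (2 * m ^ 2 + 6 * m * n + 6 * n ^ 2 + m + 3 * n =
    3 * 'C((m + 2 * n).+1, 2) + 'C(m, 2))%N.
  have := bin2_sqr (m + 2 * n).+1; have := bin2_sqr m; lia.
by rewrite exprD; move: (P0 n) (Q0 m) => h1 h2; field; rewrite h1 h2.
Qed.

(** Trisecting [m = a + b + r] gives [m + 2 n = (a + n) + (b + n) + r]. The exponent becomes a
    function of [k = a + n], [i = b + n] and [r], plus [3 a b], which is the shape [durfee_sum]
    requires. *)
Lemma capparelli_sum_first N B : (N < B)%N ->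
  \sum_(n < B) \sum_(m < B) g1 N n m * euler_coef q m =
  \sum_(r < B) \sum_(k < B) \sum_(i < B)
     q ^+ (3 * capparelli_form i k r + 2 * k + i) * I N (i + k + r) / P r * ((P k)^-1 * (P i)^-1).
Proof.
move=> NB.
transitivity (\sum_(n < B) \sum_(a < B) \sum_(b < B) \sum_(r < B)
    g1 N n (a + b + r) * (q ^+ (2 * a + b) * (e a * e b * e r))).
  apply: eq_bigr => n _; rewrite trisection_sum // => m Bm.
  by rewrite /g1 invP_small ?mulr0 ?mul0r //; lia.
under eq_bigr => n _.
  under eq_bigr => a _ do rewrite exchange_big.
  rewrite exchange_big; over.
rewrite exchange_big; apply: eq_bigr => r _ /=.
rewrite -(@durfee_sum _ p P0 B (fun k i => q ^+ (3 * capparelli_form i k r + 2 * k + i) * I N (i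
    + k + r) / P r)); last first.
  by move=> k i ki; rewrite invP_small ?mulr0 ?mul0r //; lia.
apply: eq_bigr => n _; apply: eq_bigr => a _; apply: eq_bigr => b _.
rewrite /g1 /euler_coef.
have -> : (b + n + (a + n) + r = a + b + r + 2 * n)%N by lia.
set s := (a + b + r + 2 * n)%N.
have E : (3 * 'C(s.+1, 2) + (2 * a + b) + 3 * 'C(a, 2) + 3 * 'C(b, 2) + 3 * 'C(r, 2)
    = 3 * capparelli_form (b + n) (a + n) r + 2 * (a + n) + (b + n) + 3 * (a * b))%N.
  have := bin2_sqr s.+1; have := bin2_sqr a; have := bin2_sqr b; have := bin2_sqr r.
  rewrite /capparelli_form /s; lia.
transitivity (q ^+ (3 * 'C(s.+1, 2) + (2 * a + b) + 3 * 'C(a, 2) + 3 * 'C(b, 2) + 3 * 'C(r, 2))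
   * (I N s / (P a * P b * P r * P n))).
  rewrite -!exprM !exprD; move: (P0 a) (P0 b) (P0 r) (P0 n) => h1 h2 h3 h4.
  by field; rewrite h1 h2 h3 h4.
rewrite E exprD -exprM; move: (P0 a) (P0 b) (P0 r) (P0 n) => h1 h2 h3 h4.
by field; rewrite h1 h2 h3 h4.
Qed.

(* Same computation as for the first part, with the roles of b and r exchanged in the
   trisection, which is what makes the exponent independent of n. *)
Lemma capparelli_sum_second N B : (N < B)%N ->
  \sum_(n < B) \sum_(m < B) g2 N n m * euler_coef q m =
  \sum_(r < B) \sum_(k < B) \sum_(i < B)
     q ^+ (1 + 3 * capparelli_form i k r + 4 * k + 2 * i + 3 * r) * I N (i + k + r) / P r
       * ((P k)^-1 * (P i)^-1).
Proof.
move=> NB.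
transitivity (\sum_(n < B) \sum_(a < B) \sum_(r < B) \sum_(b < B)
    g2 N n (a + r + b) * (q ^+ (2 * a + r) * (e a * e r * e b))).
  apply: eq_bigr => n _; rewrite trisection_sum // => m Bm.
  by rewrite /g2 /g1 invP_small ?mulr0 ?mul0r ?mulr0 //; lia.
under eq_bigr => n _ do rewrite exchange_big.
rewrite exchange_big; apply: eq_bigr => r _ /=.
rewrite -(@durfee_sum _ p P0 B (fun k i => q ^+ (1 + 3 * capparelli_form i k r + 4 * k + 2 * i +
    3 * r) * I N (i + k + r) / P r)); last first.
  by move=> k i ki; rewrite invP_small ?mulr0 ?mul0r //; lia.
apply: eq_bigr => n _; apply: eq_bigr => a _; apply: eq_bigr => b _.
rewrite /g2 /g1 /euler_coef.
have -> : (b + n + (a + n) + r = a + r + b + 2 * n)%N by lia.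
set s := (a + r + b + 2 * n)%N.
have E : ((1 + 2 * (a + r + b) + 3 * n) + (3 * 'C(s.+1, 2) + (2 * a + r) + 3 * 'C(a, 2) + 3 *
    'C(b, 2) + 3 * 'C(r, 2))
    = 1 + 3 * capparelli_form (b + n) (a + n) r + 4 * (a + n) + 2 * (b + n) + 3 * r + 3 * (a *
        b))%N.
  have := bin2_sqr s.+1; have := bin2_sqr a; have := bin2_sqr b; have := bin2_sqr r.
  rewrite /capparelli_form /s; lia.
transitivity (q ^+ ((1 + 2 * (a + r + b) + 3 * n) + (3 * 'C(s.+1, 2) + (2 * a + r) + 3 * 'C(a,
    2) + 3 * 'C(b, 2) + 3 * 'C(r, 2)))
   * (I N s / (P a * P b * P r * P n))).
  rewrite -!exprM !exprD; move: (P0 a) (P0 b) (P0 r) (P0 n) => h1 h2 h3 h4.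
  by field; rewrite h1 h2 h3 h4.
rewrite E exprD -exprM; move: (P0 a) (P0 b) (P0 r) (P0 n) => h1 h2 h3 h4.
by field; rewrite h1 h2 h3 h4.
Qed.

Lemma qpoch_factor_neq0 n : 1 - p ^+ n.+1 != 0.
Proof. by have := P0 n.+1; rewrite qpochSn mulf_eq0 negb_or => /andP[]. Qed.

(** Raises [N] to [N + 1] in the first part, the level that the shifted second part has; at
    [s = N + 1] both sides are 0. *)
Lemma invP_S N s : (s <= N.+1)%N -> I N s = (1 - p ^+ (N.+1 - s)) * I N.+1 s.
Proof.
rewrite leq_eqVlt => /orP[/eqP ->|sN].
  by rewrite invP_small // subnn expr0 subrr mul0r.
rewrite !invPE; [|lia|lia].
have -> : (N.+1 - s = (N - s).+1)%N by lia.
by rewrite qpochSn; move: (P0 (N - s)) (qpoch_factor_neq0 (N - s)) => h1 h2; field; rewrite ?h1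
    ?h2.
Qed.

(* The second part is reindexed by (i, k) := (k + 1, i), so that its powers of q match
   those of the first part. *)
Lemma capparelli_sum_merge N B : (N.+1 < B)%N ->
  \sum_(m < B) \sum_(n < B) capparelli_term N m n =
  \sum_(r < B) \sum_(k < B) \sum_(i < B)
     q ^+ (3 * capparelli_form i k r + 2 * k - 2 * i) * (1 - p ^+ (N.+1 - (k + r)))
       * I N.+1 (i + k + r) / P r * ((P k)^-1 * (P i)^-1).
Proof.
move=> NB.
under eq_bigr => m _ do under eq_bigr => n _ do rewrite capparelli_termE.
rewrite exchange_big /=.
under eq_bigr => n _ do rewrite big_split /=.
rewrite big_split /= capparelli_sum_first ?capparelli_sum_second ?(ltnW NB) // -big_split;
    apply: eq_bigr => r _ /=.
rewrite [X in _ + X]exchange_big -big_split; apply: eq_bigr => k _ /=.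
(* The second part shifted by one: [1 / P i] for the old index is [(1 - p^(i+1)) / P i.+1]. The
   factor [1 - p^i] makes [F 0] vanish, so summing from 0 adds nothing. *)
pose F i : K := q ^+ (3 * capparelli_form i k r + 2 * k - 2 * i) * (1 - p ^+ i)
       * I N.+1 (i + k + r) / P r * ((P k)^-1 * (P i)^-1).
transitivity (\sum_(i < B) q ^+ (3 * capparelli_form i k r + 2 * k + i) * I N (i + k + r) / P r
    * ((P k)^-1 * (P i)^-1) + \sum_(i < B) F i).
  congr (_ + _); rewrite -(@sum_ordS _ B F); first last.
  - by rewrite /F invP_small ?mulr0 ?mul0r //; lia.
  - by rewrite /F expr0 subrr mulr0 !mul0r.
  apply: eq_bigr => i _; rewrite /F.
  have -> : (3 * capparelli_form i.+1 k r + 2 * k - 2 * i.+1 = 1 + 3 * capparelli_form k i r + 4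
      * i + 2 * k + 3 * r)%N.
    by rewrite /capparelli_form; lia.
  have -> : I N.+1 (i.+1 + k + r) = I N (k + i + r).
    by rewrite /invP; have -> : (i.+1 + k + r = (k + i + r).+1)%N by [lia]; rewrite ltnS subSS.
  rewrite qpochSn; move: (P0 i) (P0 k) (P0 r) (qpoch_factor_neq0 i) => h1 h2 h3 h4.
  by field; rewrite ?h1 ?h2 ?h3 ?h4.
rewrite -big_split; apply: eq_bigr => i _ /=; rewrite /F.
have [sN|Ns] := leqP (i + k + r)%N N.+1; last first.
  by rewrite !invP_small ?(mulr0, mul0r, addr0) //; lia.
(* With [s = i + k + r], the two parts combine through [p^i (1 - p^(N+1-s)) + (1 - p^i) = 1 -
   p^(N+1-k-r)]. *)
have -> : (3 * capparelli_form i k r + 2 * k + i = (3 * capparelli_form i k r + 2 * k - 2 * i) +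
    3 * i)%N.
  by rewrite /capparelli_form; nia.
have -> : (N.+1 - (k + r) = i + (N.+1 - (i + k + r)))%N by lia.
by rewrite (invP_S sN) (exprD q _ (3 * i)) (exprM q 3) (exprD p); ring.
Qed.


Local Notation G := (gbin p).

(* u = i + r and v = k + r. *)
Lemma capparelli_sum_uv N B : (N.+1 < B)%N ->
  P N * (\sum_(m < B) \sum_(n < B) capparelli_term N m n) =
  \sum_(v < B) \sum_(u < B) q ^+ (theta_exp 0 (v%:Z - u%:Z)) * p ^+ (u * v) * (G N.+1 u * G N v).
Proof.
move=> NB; rewrite capparelli_sum_merge //.
rewrite (@sum_ord_shift2 _ B (fun r k i => q ^+ (3 * capparelli_form i k r + 2 * k - 2 * i) * (1
    - p ^+ (N.+1 - (k + r)))
       * I N.+1 (i + k + r) / P r * ((P k)^-1 * (P i)^-1))); last first.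
  by move=> r k i h; rewrite invP_small ?mulr0 ?mul0r //; lia.
rewrite mulr_sumr; apply: eq_bigr => v _; rewrite mulr_sumr; apply: eq_bigr => u _.
have [uN|Nu] := leqP u N.+1; last first.
  rewrite (gbin_small _ Nu) mul0r mulr0 big1 ?mulr0 // => r h.
  by rewrite invP_small ?mulr0 ?mul0r //; lia.
have [vN|Nv] := leqP v N; last first.
  rewrite (gbin_small _ Nv) !mulr0 big1 ?mulr0 // => r h.
  (* For [v > N] the truncated [N.+1 - v] is 0, so the factor [1 - p^0] kills the term. *)
  rewrite subnK; last lia.
  by have -> : (N.+1 - v = 0)%N by [lia]; rewrite expr0 subrr mulr0 !mul0r.
(* First q-Vandermonde sum, over [r]: it produces [[N+1, v]], and the factor [1 - p^(N+1-v)] lowers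
   it to [[N, v]] at the cost of [1 - p^(N+1)], which [P N.+1] contains. *)
have V := gbin_Vandermonde p u (N.+1 - u) v.
rewrite subnKC // in V.
have C := gbinS_compl P0 vN.
have -> : G N.+1 u * G N v = P N * ((P u)^-1 * (P (N.+1 - u))^-1 * ((1 - p ^+ (N.+1 - v)) * G
    N.+1 v)).
  rewrite C (gbinE P0 uN) qpochSn.
  move: (P0 u) (P0 (N.+1 - u)) => h1 h2.
  by field; rewrite ?h1 ?h2.
rewrite -V /gconv -(@sum_ord_le _ B v (fun r => p ^+ ((u - r) * (v - r)) * G u r * G (N.+1 - u)
    (v - r))); last first.
  by move=> r Br; rewrite (gbin_small _ (_ : (u < r)%N)) ?mulr0 ?mul0r // (leq_trans (ltn_ord u)).
rewrite !mulr_sumr [RHS](bigID (fun r : 'I_B => (r <= u)%N)) /= [X in _ + X]big1 ?addr0; last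
    first.
  by move=> r /andP[_]; rewrite -ltnNge => ur; rewrite (gbin_small _ ur) !(mulr0, mul0r).
apply: eq_bigr => r /andP[rv ru].
rewrite !gbin_invP // (invPE p ru).
have -> : I (N.+1 - u) (v - r) = I N.+1 (u - r + (v - r) + r).
  rewrite /invP; have -> : (v - r <= N.+1 - u)%N = (u - r + (v - r) + r <= N.+1)%N by lia.
  by case: ifP => // h; congr (P _)^-1; lia.
rewrite subnK //.
have -> : (3 * capparelli_form (u - r) (v - r) r + 2 * (v - r) - 2 * (u - r) =
   theta_exp 0 (v%:Z - u%:Z) + 3 * (u * v) + 3 * ((u - r) * (v - r)))%N.
  rewrite /capparelli_form; have := theta_expE 0 (v%:Z - u%:Z).
  have [a ->] : exists a, (u = a + r :> nat)%N by exists (u - r)%N; lia.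
  have [b ->] : exists b, (v = b + r :> nat)%N by exists (v - r)%N; lia.
  rewrite !addnK; nia.
rewrite exprD exprD !(exprM q 3).
move: (P0 u) (P0 (N.+1 - u)) (P0 r) (P0 (u - r)) (P0 (v - r)) => h1 h2 h3 h4 h5.
by field; rewrite ?h1 ?h2 ?h3 ?h4 ?h5.
Qed.

(** The theta exponent depends only on [v - u]. Reversing [u] to [N + 1 - u] and putting [n = u + v]
    fixes it at [n - (N + 1)], and the remaining sum over [u] is the second q-Vandermonde sum. *)
Lemma capparelli_sum N B : (N.+1 < B)%N ->
  P N * (\sum_(m < B) \sum_(n < B) capparelli_term N m n) =
  \sum_(n < (2 * N).+2) q ^+ (theta_exp 0 (n%:Z - N.+1%:Z)) * G (2 * N).+1%N n.
Proof.
move=> NB; rewrite capparelli_sum_uv // exchange_big /=.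
set T := fun u v : nat => q ^+ (theta_exp 0 (v%:Z - u%:Z)) * p ^+ (u * v) * (G N.+1 u * G N v).
rewrite (@sum_ord_widen _ N.+2 B (fun u => \sum_(v < B) T u v)) //; last first.
  by move=> u Nu; rewrite big1 // => v _; rewrite /T (gbin_small _ Nu) mul0r mulr0.
rewrite (reindex_inj rev_ord_inj) /=.
transitivity (\sum_(u < N.+2) \sum_(n < (2 * N).+2 | (u <= n)%N) T (N.+1 - u)%N (n - u)%N).
  apply: eq_bigr => u _; rewrite subSS.
  have T0 a v : (N < v)%N -> T a v = 0 by move=> Nv; rewrite /T (gbin_small _ Nv) !mulr0.
  rewrite (@sum_ord_widen _ N.+1 B (T _)); [|lia|exact: T0].
  rewrite -(@sum_ord_widen _ N.+1 (2 * N).+2 (T _)); [|lia|exact: T0].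
  by rewrite (@sum_ord_shift _ _ u) // => v h; apply: T0; move: (ltn_ord u); lia.
rewrite (exchange_big_dep xpredT) //=; apply: eq_bigr => n _.
have V := gbin_Vandermonde p N.+1 N n.
rewrite (_ : N.+1 + N = (2 * N).+1)%N in V; last lia.
rewrite -V /gconv mulr_sumr.
rewrite -(@sum_ord_le _ N.+2 n (fun i => q ^+ theta_exp 0 (n%:Z - N.+1%:Z) * (p ^+ ((N.+1 - i) *
    (n - i)) * G N.+1 i * G N (n - i)))); last first.
  by move=> i Ni; rewrite (gbin_small _ Ni) mulr0 mul0r mulr0.
apply: eq_bigr => u un; rewrite /T gbin_sym //; last by rewrite -ltnS ltn_ord.
have -> : (n - u)%N%:Z - (N.+1 - u)%N%:Z = n%:Z - N.+1%:Z by move: (ltn_ord u); lia.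
by rewrite !mulrA.
Qed.


End CapparelliSum.

(** * Bailey chain and finite triple product *)

(** With [j = b - a - 1] one has [c = a - j], so [a^2 + a = (j^2 + j) + b c], while passing from [f]
    to [f + 1] adds [3 (j^2 + j)] to the theta exponent. *)
Lemma theta_exp_bailey f a b c : (b + c = (2 * a).+1)%N ->
  (3 * (a ^ 2 + a) + theta_exp f (b%:Z - a.+1%:Z) =
   theta_exp f.+1 (b%:Z - a.+1%:Z) + 3 * (b * c))%N.
Proof.
move=> bc; have -> : c = ((2 * a).+1 - b)%N by lia.
have := theta_expE f (b%:Z - a.+1%:Z); have := theta_expE f.+1 (b%:Z - a.+1%:Z).
have hb : (b <= (2 * a).+1)%N by lia.
rewrite -mulnn; nia.
Qed.

Section BaileyChain.
Variables (K : numFieldType) (q : K).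
Local Notation p := (q ^+ 3).
Local Notation P := (qpoch p p).
Local Notation I := (invP p).
Hypothesis P0 : forall n, P n != 0.

(** The beta side in bilateral form: [n = N + 1 + j] with [-N-1 <= j <= N], and [j] and [-1 - j]
    carry the same weight [1 / (P (N+1+j) P (N-j))]. *)
Definition bailey_beta f N : K :=
  \sum_(n < (2 * N).+2) q ^+ theta_exp f (n%:Z - N.+1%:Z) * ((P n)^-1 * I (2 * N).+1%N n).

(** Put [N = M - t] and [n = J - t]: then [j = J - M - 1] does not involve [t], and the sum over [t]
    is the Durfee identity for [J] and [2 M + 1 - J]. *)
Lemma bailey_step f M :
  \sum_(N < M.+1) p ^+ (N ^ 2 + N) * I M N * bailey_beta f N = bailey_beta f.+1 M.
Proof.
rewrite (reindex_inj rev_ord_inj) /=.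
pose T (t J : nat) : K := p ^+ ((M - t) ^ 2 + (M - t)) * (P t)^-1 *
  (q ^+ theta_exp f (J%:Z - M.+1%:Z) * ((P (J - t))^-1 * I (2 * (M - t)).+1%N (J - t))).
transitivity (\sum_(t < M.+1) \sum_(J < (2 * M).+2 | (t <= J)%N) T t J).
  apply: eq_bigr => t _; rewrite subSS.
  have tM : (t <= M)%N by rewrite -ltnS.
  rewrite /bailey_beta -(@sum_ord_widen _ _ (2 * M).+2
    (fun n => q ^+ theta_exp f (n%:Z - (M - t).+1%:Z) * ((P n)^-1 * I (2 * (M - t)).+1%N n)));
        first last.
  - by move=> n hn; rewrite invP_small ?mulr0.
  - lia.
  rewrite (@sum_ord_shift _ _ t (fun n => q ^+ theta_exp f (n%:Z - (M - t).+1%:Z) * ((P n)^-1 *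
      I (2 * (M - t)).+1%N n))); last first.
    by move=> n hn; rewrite invP_small ?mulr0 //; lia.
  rewrite mulr_sumr; apply: eq_bigr => J tJ; rewrite /T invPE ?leq_subr // subKn //.
  by have -> : (J - t)%N%:Z - (M - t).+1%:Z = J%:Z - M.+1%:Z by lia.
rewrite (exchange_big_dep xpredT) //=; apply: eq_bigr => J _.
have JM : (J <= (2 * M).+1)%N by rewrite -ltnS ltn_ord.
rewrite (invPE _ JM); set J' := ((2 * M).+1 - J)%N.
rewrite -(@durfee _ p P0 J.+1 J' J (ltnSn J)) mulr_sumr.
rewrite -(@sum_ord_le _ M.+1 J (fun t => q ^+ theta_exp f.+1 (J%:Z - M.+1%:Z) * (p ^+ ((J - t) *
    (J' - t)) *
     (I J t * I J' t / P t)))); last first.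
  (* Since [J + J' = 2 M + 1], the smaller of the two is at most [M]. *)
  move=> t Mt; have [/invP_small ->|/invP_small ->] : (J < t)%N \/ (J' < t)%N by rewrite /J'; lia.
    by rewrite !mul0r !mulr0.
  by rewrite mulr0 mul0r !mulr0.
apply: eq_bigr => t tJ; rewrite /T (invPE _ tJ).
have -> : I (2 * (M - t)).+1%N (J - t) = I J' t.
  rewrite /invP /J'; have tM : (t <= M)%N by rewrite -ltnS.
  have -> : (J - t <= (2 * (M - t)).+1)%N = (t <= (2 * M).+1 - J)%N by lia.
  by case: ifP => // h; congr (P _)^-1; lia.
have [tJ'|J't] := leqP t J'; last by rewrite (invP_small _ J't) !(mulr0, mul0r).
have E : (3 * ((M - t) ^ 2 + (M - t)) + theta_exp f (J%:Z - M.+1%:Z) =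
   theta_exp f.+1 (J%:Z - M.+1%:Z) + 3 * ((J - t) * (J' - t)))%N.
  have tM : (t <= M)%N by rewrite -ltnS.
  have -> : J%:Z - M.+1%:Z = (J - t)%N%:Z - (M - t).+1%N%:Z by lia.
  by apply: theta_exp_bailey; rewrite /J' in tJ' *; lia.
transitivity (q ^+ (3 * ((M - t) ^ 2 + (M - t)) + theta_exp f (J%:Z - M.+1%:Z)) * ((P (J -
    t))^-1 * I J' t / P t)).
  by rewrite (exprD q (3 * _)) (exprM q 3); ring.
by rewrite E (exprD q _ (3 * _)) (exprM q 3); ring.
Qed.

Lemma capparelli_beta N B : (forall n, qpoch q q n != 0) -> (N.+1 < B)%N ->
  P N / P (2 * N).+1%N * (\sum_(m < B) \sum_(n < B) capparelli_term q N m n) = bailey_beta 0 N.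
Proof.
move=> Q0 NB; rewrite mulrAC capparelli_sum // mulr_suml; apply: eq_bigr => n _.
by rewrite gbin_invP //; move: (P0 n) (P0 (2 * N).+1) => h1 h2; field; rewrite h1 h2.
Qed.

End BaileyChain.

Section TripleProduct.
Variables (K : numFieldType) (q : K) (f : nat).
Local Notation c := (6 * f + 6)%N.
Local Notation x := (q ^+ c).
Hypothesis P0 : forall n, qpoch x x n != 0.

(** The theta sum over [-M1 <= j <= M2]. Independent cutoffs let each factor of the triple product
    come from its own induction. *)
Definition finite_theta M1 M2 : K :=
  \sum_(n < (M1 + M2).+1) q ^+ theta_exp f (n%:Z - M1%:Z) * gbin x (M1 + M2) n.

(** Since [theta_exp f j - theta_exp f (j - 1) = (6 f + 6) j - 1], the two halves of q-Pascal are
    the old sum and [q x^M1] times the old sum. *)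
Lemma finite_theta_left M1 M2 :
  finite_theta M1.+1 M2 = (1 + q * x ^+ M1) * finite_theta M1 M2.
Proof.
rewrite /finite_theta addSn big_ord_recl gbin0 /= mulr1 mulrDl mul1r.
under eq_bigr => n _ do rewrite /bump /= add1n gbinS mulrDr.
rewrite big_split /= addrCA; congr (_ + _).
  by apply: eq_bigr => n _; congr (q ^+ theta_exp f _ * _); lia.
rewrite [X in _ + X]big_ord_recr /= gbin_small // !mulr0 addr0.
rewrite [in RHS]big_ord_recl mulrDr gbin0 mulr1 mulr_sumr; congr (_ + _).
  rewrite -exprM -exprS -exprD /=; congr (_ ^+ _).
  have := theta_expE f (0%:Z - M1%:Z); have := theta_expE f (0%:Z - M1.+1%:Z); nia.
apply: eq_bigr => n _; rewrite /= /bump /= add1n.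
rewrite -!exprM !mulrA -exprS -!exprD; congr (q ^+ _ * _).
have := theta_expE f (n.+1%:Z - M1%:Z); have := theta_expE f (n.+1%:Z - M1.+1%:Z).
nia.
Qed.

(** Same argument with the mirrored q-Pascal rule and [theta_exp f (j + 1) - theta_exp f j = (6 f +
    6) j + 6 f + 5]. *)
Lemma finite_theta_right M1 M2 :
  finite_theta M1 M2.+1 = (1 + q ^+ (6 * f + 5) * x ^+ M2) * finite_theta M1 M2.
Proof.
rewrite /finite_theta addnS big_ord_recl gbin0 /= mulr1 mulrDl mul1r.
under eq_bigr => n _ do rewrite /bump /= add1n gbinS_left -1?ltnS // mulrDr.
rewrite big_split /= addrCA addrC; congr (_ + _).
  rewrite [X in _ + X]big_ord_recr /= gbin_small // mulr0 addr0.
  by rewrite [in RHS]big_ord_recl /= gbin0 mulr1.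
rewrite mulr_sumr; apply: eq_bigr => n _.
rewrite -!exprM !mulrA -!exprD; congr (q ^+ _ * _).
have := theta_expE f (n%:Z - M1%:Z); have := theta_expE f (n.+1%:Z - M1%:Z).
case: n => n /= nM.
have [d dE] : exists d, (M2%:Z = (d + n)%N%:Z - M1%:Z) by exists (M1 + M2 - n)%N; lia.
have -> : (M1 + M2 - n = d)%N by lia.
nia.
Qed.

Lemma finite_triple_product M :
  finite_theta M M = qpoch (- q) x M * qpoch (- q ^+ (6 * f + 5)) x M.
Proof.
have E M2 : finite_theta 0 M2 = qpoch (- q ^+ (6 * f + 5)) x M2.
  elim: M2 => [|M2 IH].
    rewrite /finite_theta big_ord1 /= subr0 gbin0 mulr1 qpoch0 -[RHS](expr0 q); congr (_ ^+ _).
    by have := theta_expE f 0%:Z; lia.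
  by rewrite finite_theta_right IH qpochS mulNr opprK mulrC.
have {}E M1 M2 : finite_theta M1 M2 = qpoch (- q) x M1 * qpoch (- q ^+ (6 * f + 5)) x M2.
  elim: M1 => [|M1 IH]; first by rewrite E qpoch0 mul1r.
  by rewrite finite_theta_left IH qpochS mulNr opprK; ring.
exact: E.
Qed.

End TripleProduct.

(** * Boxes of tuples and the iterated Bailey chain *)

Fixpoint tuple_box (B f : nat) : seq (f.-tuple nat) :=
  match f with
  | 0 => [:: [tuple]]
  | f'.+1 => [seq cons_tuple n s | n <- iota 0 B, s <- tuple_box B f']
  end.

Lemma mem_tuple_box B f (s : f.-tuple nat) :
  (s \in tuple_box B f) = all (fun n => (n < B)%N) s.
Proof.
elim: f s => [|f IH] s; first by rewrite (tuple0 s) inE eqxx.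
rewrite (tuple_eta s) /=; apply/allpairsP/andP => /=.
  case=> -[n t] /= [nB tB E].
  have := congr1 val E; rewrite /= => -[-> Et].
  rewrite mem_iota add0n in nB; split => //.
  by rewrite Et -IH.
case=> sB tB; exists (thead s, [tuple of behead s]) => /=.
by rewrite mem_iota add0n sB IH.
Qed.

Lemma uniq_tuple_box B f : uniq (tuple_box B f).
Proof.
elim: f => //= f IH; apply: allpairs_uniq => //; first exact: iota_uniq.
move=> [n s] [n' s'] _ _ /= E; have := congr1 val E; rewrite /= => -[-> Es].
by congr (_, _); apply: val_inj.
Qed.

Lemma sum_tuple_box (V : nmodType) B f (F : f.+1.-tuple nat -> V) :
  \sum_(s <- tuple_box B f.+1) F s =
  \sum_(n < B) \sum_(s <- tuple_box B f) F (cons_tuple (nat_of_ord n) s).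
Proof.
rewrite -(big_mkord xpredT (fun n => \sum_(s <- tuple_box B f) F (cons_tuple n s))).
by rewrite /index_iota subn0 big_allpairs_dep.
Qed.

Lemma tailsum_cons0 f n (s : f.-tuple nat) :
  tailsum (cons_tuple n s) 0 = (n + tailsum s 0)%N.
Proof. by rewrite /tailsum big_ltn // big_add1. Qed.

Lemma tailsum_consS f n (s : f.-tuple nat) i :
  tailsum (cons_tuple n s) i.+1 = tailsum s i.
Proof. by rewrite /tailsum big_add1. Qed.

Section Chain.
Variables (K : numFieldType) (q : K).
Local Notation p := (q ^+ 3).
Local Notation P := (qpoch p p).
Local Notation I := (invP p).

(** The tuple-dependent part of the summand, [g] collecting what depends on the last entry [n_f].
    Length [f + 1] guarantees that this entry exists. *)
Definition chain_weight (g : nat -> K) f (s : f.+1.-tuple nat) : K :=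
  p ^+ (\sum_(i < f.+1) tailsum s i ^ 2 + \sum_(i < f.+1) tailsum s i)
  / (\prod_(i < f) P (nth 0%N s i)) * g (nth 0%N s f).

Lemma chain_weight_cons g f n (s : f.+1.-tuple nat) :
  chain_weight g (cons_tuple n s) =
  p ^+ ((n + tailsum s 0) ^ 2 + (n + tailsum s 0)) / P n * chain_weight g s.
Proof.
have E (h : nat -> nat) : (\sum_(i < f.+2) h (tailsum (cons_tuple n s) i) =
    h (n + tailsum s 0) + \sum_(i < f.+1) h (tailsum s i))%N.
  rewrite big_ord_recl tailsum_cons0; congr addn.
  by apply: eq_bigr => i _; rewrite lift0 tailsum_consS.
rewrite /chain_weight (E id) (E (expn^~ 2%N)) [\prod_(i < f.+1) _]big_ord_recl /=.
by rewrite addnACA exprD invfM; ring.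
Qed.

(** Peel off the first entry: with [N = N_1] it equals [N - N_2], so its factor [1 / P] is the
    truncation [I N N_2] of the shorter chain at level [N]. Agreement of [w] with [b 0] is asked
    only inside the box because [w] will itself be a sum truncated at [B]. *)
Lemma chain_sum (b : nat -> nat -> K) :
  (forall g M, \sum_(N < M.+1) p ^+ (N ^ 2 + N) * I M N * b g N = b g.+1 M) ->
  forall f M B (w : nat -> K), (M.+1 < B)%N -> (forall N, (N.+1 < B)%N -> w N = b 0%N N) ->
  \sum_(s <- tuple_box B f.+1) chain_weight w s * I M (tailsum s 0) = b f.+1 M.
Proof.
move=> step f M B w MB wb.
have widen M' (F : nat -> K) : (M' < B)%N ->
    \sum_(N < B) p ^+ (N ^ 2 + N) * I M' N * F N = \sum_(N < M'.+1) p ^+ (N ^ 2 + N) * I M' N *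
        F N.
  move=> MB'; apply: (@sum_ord_widen _ M'.+1 B (fun N => p ^+ (N ^ 2 + N) * I M' N * F N)) => //
      N hN.
  by rewrite invP_small // mulr0 mul0r.
elim: f M MB => [|f IH] M MB.
  rewrite -step -widen ?(ltnW MB) // sum_tuple_box.
  apply: eq_bigr => n _.
  rewrite big_seq1 tailsum_cons0 /chain_weight !big_ord1 big_ord0 /= tailsum_cons0.
  rewrite /tailsum big_geq // addn0 divr1.
  have [Mn|nM] := ltnP M n; first by rewrite invP_small // !(mulr0, mul0r).
  by rewrite wb; [rewrite mulrAC|lia].
rewrite -step -widen ?(ltnW MB) // sum_tuple_box exchange_big /=.
transitivity (\sum_(s <- tuple_box B f.+1) \sum_(N < B) p ^+ (N ^ 2 + N) * I M N *
    (chain_weight w s * I N (tailsum s 0))).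
  apply: eq_bigr => s _; set T := tailsum s 0.
  under eq_bigr => i _ do rewrite chain_weight_cons tailsum_cons0.
  rewrite (@sum_ord_shift _ B T (fun i => p ^+ ((i + T) ^ 2 + (i + T)) / P i * chain_weight w s
      * I M (i + T))); last first.
    by move=> a Ba; rewrite invP_small ?mulr0 //; lia.
  rewrite big_mkcond; apply: eq_bigr => N _.
  case: leqP => TN; last by rewrite (invP_small _ TN) !mulr0.
  by rewrite subnK // (invPE _ TN); ring.
rewrite exchange_big; apply: eq_bigr => N _ /=.
rewrite -mulr_sumr; have [MN|NM] := ltnP M N; first by rewrite invP_small // mulr0 !mul0r.
by rewrite IH //; lia.
Qed.

Hypothesis P0 : forall n, P n != 0.
Hypothesis Q0 : forall n, qpoch q q n != 0.

Lemma inv_qpoch_invP N m n : inv_qpoch p p (N%:Z - 2%:Z * n%:Z - m%:Z) = I N (m + 2 * n).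
Proof.
have [h|h] := leqP (m + 2 * n)%N N.
  have -> : N%:Z - 2%:Z * n%:Z - m%:Z = (N - (m + 2 * n))%N%:Z by lia.
  by rewrite invPE.
rewrite invP_small //; case E : (N%:Z - 2%:Z * n%:Z - m%:Z) => [a|a] //.
by move: E h; lia.
Qed.

Lemma multisum_termE f m n (s : f.+1.-tuple nat) :
  multisum_term q (m, n, s) =
  chain_weight (fun N => P N / P (2 * N).+1%N * capparelli_term q N m n) s.
Proof.
rewrite /multisum_term /multisum_exponent /chain_weight /capparelli_term /=.
rewrite inv_qpoch_invP addn1 exprD (exprM q 3) !invfM.
ring.
Qed.

Lemma multisum_finite f M B : (M.+1 < B)%N ->
  \sum_(m < B) \sum_(n < B) \sum_(s <- tuple_box B f.+1)
     multisum_term q (nat_of_ord m, nat_of_ord n, s) * I M (tailsum s 0) = bailey_beta q f.+1 M.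
Proof.
move=> MB.
pose w N := \sum_(m < B) \sum_(n < B) P N / P (2 * N).+1%N * capparelli_term q N m n.
rewrite -(@chain_sum (bailey_beta q) (@bailey_step _ q P0) f M B w) //; last first.
  move=> N NB; rewrite -(capparelli_beta P0 Q0 NB) mulr_sumr.
  by apply: eq_bigr => m _; rewrite mulr_sumr.
rewrite exchange_big.
under eq_bigr => m _ do rewrite exchange_big.
rewrite exchange_big; apply: eq_bigr => s _.
rewrite /chain_weight mulr_sumr mulr_suml exchange_big; apply: eq_bigr => m _.
rewrite mulr_sumr mulr_suml; apply: eq_bigr => n _.
by rewrite multisum_termE.
Qed.

End Chain.

(** * Unconditional sums of complex families *)

#[local] Existing Instance totally_filter.

Section Families.
Variables (C : numFieldType) (I : choiceType).
Implicit Types x : I -> C.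

Lemma fset_sum_sub (V : zmodType) (x : I -> V) (A B : {fset I}) : (A `<=` B)%fset ->
  \sum_(i <- B) x i = \sum_(i <- A) x i + \sum_(i <- (B `\` A)%fset) x i.
Proof.
move=> AB; rewrite (big_fsetID _ (mem A)) /=; congr (_ + _); apply: eq_fbigl => i.
  by rewrite !inE /=; case: (boolP (i \in A)) => [/(fsubsetP AB) ->|]; rewrite ?andbF.
by rewrite !inE andbC.
Qed.

Lemma partial_sumE x (A : {fset I}) : partial_sum x A = \sum_(i <- A) x i.
Proof. by rewrite /partial_sum big_seq_fsetE. Qed.

Lemma uncond_cvg_sum x : uncond_cvg x -> partial_sum x @ totally --> sum x.
Proof. by []. Qed.

Lemma sum_fset_seq (V : nmodType) (r : seq I) (F : I -> V) : uniq r ->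
  \sum_(i <- [fset i in r]%fset) F i = \sum_(i <- r) F i.
Proof.
move=> ur; apply: perm_big; apply: uniq_perm; rewrite ?fset_uniq // => i.
by rewrite !inE.
Qed.

Lemma cvg_sum_mul (r : seq I) x (w : nat -> I -> C) (l : C) :
  (forall i, w M i @[M --> \oo] --> l) ->
  (\sum_(i <- r) x i * w M i) @[M --> \oo] --> (\sum_(i <- r) x i) * l.
Proof.
move=> wl; elim: r => [|i r IH].
  by rewrite big_nil mul0r; under eq_fun do rewrite big_nil; exact: cvg_cst.
rewrite big_cons mulrDl; under eq_fun do rewrite big_cons.
exact: (cvgD (cvgM (cvg_cst (x i)) (wl i)) IH).
Qed.

(** Dominated convergence along the net of finite sets: bounded weights with a common pointwise
    limit [l], and finite support of each weighted family. *)
Lemma tannery x (w : nat -> I -> C) (c l : C) (E : nat -> seq I) (y : nat -> C) :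
  (forall e : C, 0 < e -> exists A0 : {fset I}, forall A, (A0 `<=` A)%fset ->
     \sum_(i <- (A `\` A0)%fset) `|x i| <= e) ->
  uncond_cvg x -> 0 <= c -> (forall M i, `|w M i| <= c) ->
  (forall i, w M i @[M --> \oo] --> l) ->
  (forall M, uniq (E M)) -> (forall M i, i \notin E M -> x i * w M i = 0) ->
  (forall M, y M = \sum_(i <- E M) x i * w M i) ->
  y M @[M --> \oo] --> sum x * l.
Proof.
move=> dx cx c0 wc wl uE xE yE; apply/cvgrPdist_le => e e0.
have k0 : 0 < c + `|l| + 1 by rewrite ltr_wpDl // addr_ge0.
(* The errors from the tail, from [sum x] and from the weights on [A] will be at most [d * c],
   [d * |l|] and [d], which add up to [e]. *)
pose d := e / (c + `|l| + 1); have d0 : 0 < d by rewrite divr_gt0.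
have /cvgrPdist_le /(_ _ d0)[A1 _ h1] := uncond_cvg_sum cx.
have [A2 h2] := dx _ d0.
pose A := (A1 `|` A2)%fset.
have /cvgrPdist_le /(_ _ d0) := @cvg_sum_mul A x w l wl.
apply: filterS => M hM.
(* Enlarging [E M] by [A] adds only zero terms, and the sum can then be split at [A]. *)
have -> : y M = \sum_(i <- A) x i * w M i + \sum_(i <- (([fset i in E M] `|` A) `\` A)%fset) x i
    * w M i.
  rewrite yE -fset_sum_sub ?fsubsetUr // -(sum_fset_seq _ (uE M)).
  apply: big_fset_incl; first exact: fsubsetUl.
  by move=> i _; rewrite inE => /xE.
have -> : e = d * c + d * `|l| + d.
  by rewrite -!mulrDr -[X in _ + X]mulr1 -mulrDr divfK // gt_eqF.
set T1 := \sum_(i <- A) x i * w M i in hM *; set S := \sum_(i <- A) x i in hM.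
set T2 := \sum_(i <- _) _.
have -> : sum x * l - (T1 + T2) = - T2 + (sum x - S) * l + (S * l - T1) by ring.
rewrite (le_trans (ler_normD _ _)) // lerD // (le_trans (ler_normD _ _)) // lerD //; last first.
  rewrite normrM ler_wpM2r //; have := h1 A (fsubsetUl _ _).
  by rewrite partial_sumE.
rewrite normrN (le_trans (ler_norm_sum _ _ _)) //.
set B := ([fset i in E M] `|` A)%fset.
apply: (@le_trans _ _ (\sum_(i <- (B `\` A2)%fset) `|x i| * c)); last first.
  rewrite -mulr_suml ler_wpM2r // h2 //.
  by rewrite (fsubset_trans (fsubsetUr A1 A2)) // fsubsetUr.
have sub : (B `\` A `<=` B `\` A2)%fset by rewrite fsetDS // fsubsetUr.
rewrite [leRHS](fset_sum_sub _ sub) ler_wpDr //; first by apply: sumr_ge0 => i _; rewrite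
    mulr_ge0.
by apply: ler_sum => i _; rewrite normrM ler_wpM2l.
Qed.


End Families.

Section RealFamilies.
Variables (R : realType) (I : choiceType).
Implicit Types (g y : I -> R).

Lemma nonneg_family_cvg g (M : R) : (forall i, 0 <= g i) ->
  (forall A : {fset I}, \sum_(i <- A) g i <= M) ->
  exists s, forall e, 0 < e -> exists A0 : {fset I}, forall A, (A0 `<=` A)%fset ->
    `|\sum_(i <- A) g i - s| <= e.
Proof.
move=> g0 gM; pose E := range (fun A : {fset I} => \sum_(i <- A) g i).
have hE : has_sup E.
  by split; [exists (\sum_(i <- fset0 : {fset I}) g i), fset0|exists M => _ [A _ <-]].
exists (sup E) => e e0; have [_ [A0 _ <-] lt] := sup_adherent e0 hE.
exists A0 => A sA; have le : \sum_(i <- A) g i <= sup E by apply: sup_upper_bound => //; exists A.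
rewrite (fset_sum_sub _ sA) in le *.
have ge0 : 0 <= \sum_(i <- (A `\` A0)%fset) g i by apply: sumr_ge0.
by rewrite ler_distl; apply/andP; split; lra.
Qed.

(** Write [y = (y + g) - g], a difference of nonnegative families with bounded partial sums. *)
Lemma dominated_family_cvg g y (M : R) : (forall i, `|y i| <= g i) ->
  (forall A : {fset I}, \sum_(i <- A) g i <= M) ->
  exists s, forall e, 0 < e -> exists A0 : {fset I}, forall A, (A0 `<=` A)%fset ->
    `|\sum_(i <- A) y i - s| <= e.
Proof.
move=> yg gM; have g0 i : 0 <= g i by apply: le_trans (yg i).
have [s hs] := nonneg_family_cvg g0 gM.
have [i|A|t ht] := @nonneg_family_cvg (fun i => y i + g i) (M + M).
- by have := yg i; rewrite ler_norml => /andP[]; lra.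
- rewrite big_split /= lerD // (le_trans _ (gM A)) // ler_sum // => i _.
  exact: le_trans (ler_norm _) (yg i).
exists (t - s) => e e0; have e2 : 0 < e / 2 by rewrite divr_gt0.
have [A1 h1] := hs _ e2; have [A2 h2] := ht _ e2.
exists (A1 `|` A2)%fset => A; rewrite fsubUset => /andP[s1 s2].
have := h1 _ s1; have := h2 _ s2; rewrite big_split /= !ler_distl => /andP[? ?] /andP[? ?].
by apply/andP; split; lra.
Qed.

End RealFamilies.

Section ComplexFamilies.
Variables (R : realType) (I : choiceType).
Local Notation C := (R[i] : numFieldType).
Implicit Types x : I -> C.

(** Absolute summability. The bound is real although typed as complex, because it lies above the
    empty sum 0. *)
Definition dominated x := exists M : C, forall A : {fset I}, \sum_(i <- A) `|x i| <= M.

Lemma complex_gt0P (e : C) : 0 < e -> exists2 r : R, 0 < r & e = r%:C%C.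
Proof.
move=> e0; have E : e = (complex.Re e)%:C%C by rewrite RRe_real // gtr0_real.
by exists (complex.Re e) => //; rewrite -ltcR -E.
Qed.

Lemma norm_ReE (z : C) : `|z| = (complex.Re `|z|)%:C%C.
Proof. by rewrite RRe_real // normr_real. Qed.

Lemma dominated_real x : dominated x ->
  exists M : R, forall A : {fset I}, \sum_(i <- A) complex.Re `|x i| <= M.
Proof.
move=> [M hM]; exists (complex.Re M) => A.
have M0 : 0 <= M by have := hM fset0; rewrite big_seq_fset0.
have ME : M = (complex.Re M)%:C%C by rewrite RRe_real // ger0_real.
rewrite -lecR -ME rmorph_sum /=; apply: le_trans (hM A).
by apply: ler_sum => i _; rewrite [leRHS]norm_ReE lexx.
Qed.

Lemma dominated_tail x (e : C) : dominated x -> 0 < e ->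
  exists A0 : {fset I}, forall A, (A0 `<=` A)%fset -> \sum_(i <- (A `\` A0)%fset) `|x i| <= e.
Proof.
move=> /dominated_real[M hM] /complex_gt0P[{}e e0 ->].
have g0 i : 0 <= complex.Re `|x i| by rewrite -ler0c -norm_ReE.
have [s hs] := nonneg_family_cvg g0 hM.
have [A0 h0] := hs _ (divr_gt0 e0 (ltr0Sn _ 1)).
exists A0 => A sA.
have := h0 _ sA; have := h0 _ (fsubset_refl A0).
rewrite !ler_distl (fset_sum_sub _ sA) => /andP[? ?] /andP[? ?].
have -> : \sum_(i <- (A `\` A0)%fset) `|x i| = (\sum_(i <- (A `\` A0)%fset) complex.Re `|x
    i|)%:C%C.
  by rewrite rmorph_sum; apply: eq_bigr => i _; exact: norm_ReE.
rewrite lecR; lra.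
Qed.

Lemma normc_le_ReIm (z : C) (a b : R) : `|complex.Re z| <= a -> `|complex.Im z| <= b ->
  `|z| <= (a + b)%:C%C.
Proof.
move=> ha hb; rewrite {1}(complexE z) (le_trans (ler_normD _ _)) // rmorphD lerD //.
  by rewrite normc_def /= expr0n /= addr0 sqrtr_sqr lecR.
rewrite normrM; have -> : `|'i%C| = 1 :> C.
  by rewrite normc_def /= expr0n /= add0r expr1n sqrtr1.
by rewrite mul1r normc_def /= expr0n /= addr0 sqrtr_sqr lecR.
Qed.

Lemma dominated_cvg x : dominated x -> uncond_cvg x.
Proof.
move=> /dominated_real[M hM].
have hRe i : `|complex.Re (x i)| <= complex.Re `|x i|.
  by rewrite -lecR -norm_ReE normc_ge_Re.
have hIm i : `|complex.Im (x i)| <= complex.Re `|x i|.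
  rewrite normc_def /= -sqrtr_sqr ler_sqrt ?addr_ge0 ?sqr_ge0 //.
  by rewrite lerDr sqr_ge0.
have [a ha] := dominated_family_cvg hRe hM; have [b hb] := dominated_family_cvg hIm hM.
apply/cvg_ex; exists (a +i* b)%C; apply/cvgrPdist_le => _ /complex_gt0P[e e0 ->].
have e2 := divr_gt0 e0 (ltr0Sn R 1).
have [A1 h1] := ha _ e2; have [A2 h2] := hb _ e2.
exists (A1 `|` A2)%fset => // A /=; rewrite fsubUset => /andP[s1 s2].
rewrite distrC partial_sumE [e]splitr.
apply: normc_le_ReIm.
  by rewrite raddfB raddf_sum; apply: h1.
by rewrite raddfB raddf_sum; apply: h2.
Qed.

(** Every finite set lies in some [E B], so bounds along one exhausting sequence suffice. *)
Lemma dominated_exhaust x (E : nat -> seq I) (M : C) :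
  (forall B, uniq (E B)) -> (forall i, exists B, forall B', (B <= B')%N -> i \in E B') ->
  (forall B, \sum_(i <- E B) `|x i| <= M) -> dominated x.
Proof.
move=> uE EI EM; exists M => A.
have [B hB] : exists B, forall B', (B <= B')%N -> {subset (A : seq I) <= E B'}.
  elim: (A : seq I) => [|i r [B hB]]; first by exists 0%N.
  have [B1 hB1] := EI i; exists (maxn B B1) => B'; rewrite geq_max => /andP[b b1] j.
  by rewrite inE => /orP[/eqP ->|/(hB _ b)//]; apply: hB1.
have sA : (A `<=` [fset i in E B])%fset by apply/fsubsetP => i /(hB _ (leqnn B)); rewrite inE.
apply: le_trans (EM B); rewrite -(sum_fset_seq _ (uE B)) (fset_sum_sub _ sA) lerDl.
by apply: sumr_ge0.
Qed.

Lemma dominated_tannery x (w : nat -> I -> C) (c l : C) (E : nat -> seq I) (y : nat -> C) :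
  dominated x -> 0 <= c -> (forall M i, `|w M i| <= c) ->
  (forall i, w M i @[M --> \oo] --> l) ->
  (forall M, uniq (E M)) -> (forall M i, i \notin E M -> x i * w M i = 0) ->
  (forall M, y M = \sum_(i <- E M) x i * w M i) ->
  y M @[M --> \oo] --> sum x * l.
Proof.
move=> dx; apply: tannery; first by move=> e; exact: dominated_tail.
exact: dominated_cvg.
Qed.

End ComplexFamilies.

(** * Limits *)

Section QPochhammerBounds.
Variables (K : numFieldType).
Implicit Types a p r : K.

Lemma sum_geometric_le r n : 0 <= r -> r < 1 -> \sum_(k < n) r ^+ k <= (1 - r)^-1.
Proof.
move=> r0 r1; have h : 0 < 1 - r by rewrite subr_gt0.
rewrite -(ler_pM2l h) divff ?gt_eqF //.
have -> : (1 - r) * \sum_(k < n) r ^+ k = 1 - r ^+ n.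
  by rewrite -[LHS]opprK -mulNr opprB -subrX1 opprB.
by rewrite gerBl exprn_ge0.
Qed.

Lemma norm_qpoch_le a p n : `|qpoch a p n| <= \prod_(k < n) (1 + `|a| * `|p| ^+ k).
Proof.
rewrite /qpoch normr_prod; apply: ler_prod => k _; rewrite normr_ge0 /=.
by rewrite (le_trans (ler_normB _ _)) // normr1 normrM normrX.
Qed.

Lemma one_sub_norm_gt0 p k : `|p| < 1 -> 0 < 1 - `|p| ^+ k.+1.
Proof. by move=> p1; rewrite subr_gt0 exprn_ilt1. Qed.

Lemma norm_one_sub_ge p k : 1 - `|p| ^+ k <= `|1 - p ^+ k|.
Proof. by rewrite -normrX -{1}(normr1 K) lerB_dist. Qed.

Lemma one_sub_neq0 p k : `|p| < 1 -> 1 - p ^+ k.+1 != 0.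
Proof.
move=> p1; rewrite -normr_gt0; exact: lt_le_trans (one_sub_norm_gt0 k p1) (norm_one_sub_ge _ _).
Qed.

Lemma qpoch_neq0 p n : `|p| < 1 -> qpoch p p n != 0.
Proof.
move=> p1; elim: n => [|n IH]; first by rewrite qpoch0 oner_eq0.
by rewrite qpochSn mulf_neq0 // one_sub_neq0.
Qed.

(** From [1 / (1 - t) = 1 + t / (1 - t)]: this has the same product shape as [norm_qpoch_le], so
    [prod_bounded] serves both. *)
Lemma norm_qpochV_le p n : `|p| < 1 ->
  `|(qpoch p p n)^-1| <= \prod_(k < n) (1 + `|p| / (1 - `|p|) * `|p| ^+ k).
Proof.
move=> p1; rewrite /qpoch -prodfV normr_prod; apply: ler_prod => k _; rewrite normr_ge0 /=.
rewrite -exprS normfV.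
have h := one_sub_norm_gt0 k p1.
have h1 : 0 < 1 - `|p| by rewrite subr_gt0.
apply: (@le_trans _ _ (1 - `|p| ^+ k.+1)^-1).
  by rewrite lef_pV2 ?posrE ?norm_one_sub_ge // normr_gt0 one_sub_neq0.
have -> : (1 - `|p| ^+ k.+1)^-1 = 1 + `|p| ^+ k.+1 / (1 - `|p| ^+ k.+1).
  by field; rewrite gt_eqF.
rewrite lerD2l mulrAC -exprS ler_wpM2l ?exprn_ge0 // lef_pV2 ?posrE //.
by rewrite lerD2l lerN2 exprS ler_piMr // exprn_ile1 // ltW.
Qed.

Lemma cvg_comp_oo (u : nat -> K) (l : K) (phi : nat -> nat) :
  (forall A, exists M0, forall M, (M0 <= M)%N -> (A <= phi M)%N) ->
  u @ \oo --> l -> u (phi M) @[M --> \oo] --> l.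
Proof.
move=> hphi; apply: cvg_comp => S [N _ hN]; have [M0 hM] := hphi N.
by exists M0 => // M /= /hM; exact: hN.
Qed.

Lemma cvg_eventually (u v : nat -> K) (l : K) (M0 : nat) :
  (forall M, (M0 <= M)%N -> u M = v M) -> u @ \oo --> l -> v @ \oo --> l.
Proof.
move=> uv; apply: cvg_trans; apply: near_eq_cvg.
by exists M0 => // M /= /uv.
Qed.

Lemma cvg_seq_unique (u : nat -> K) (l l' : K) : u @ \oo --> l -> u @ \oo --> l' -> l = l'.
Proof. exact: cvg_unique. Qed.

Lemma cvg_addr_const (u : nat -> K) (c l : K) :
  (u M - c) @[M --> \oo] --> l -> u M @[M --> \oo] --> l + c.
Proof.
move=> ul; have h : (u M - c + c) @[M --> \oo] --> l + c.
  by apply: cvgD => //; exact: cvg_cst.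
by apply: (@cvg_eventually _ _ _ 0%N _ h) => M _; rewrite subrK.
Qed.

End QPochhammerBounds.

Section QPochhammerLimit.
Variable (R : realType).
Local Notation C := (R[i] : numFieldType).
Implicit Types a p r c : C.

(** By [1 + t <= exp t] and the geometric series, [exp (c / (1 - r))] is a bound. *)
Lemma prod_bounded c r : 0 <= c -> 0 <= r -> r < 1 ->
  exists2 B : C, 0 <= B & forall n, \prod_(k < n) (1 + c * r ^+ k) <= B.
Proof.
move=> c0 r0 r1.
have [s sE] : exists s : R, c = s%:C%C by exists (complex.Re c); rewrite RRe_real // ger0_real.
have [t tE] : exists t : R, r = t%:C%C by exists (complex.Re r); rewrite RRe_real // ger0_real.
move: c0 r0 r1; rewrite sE tE !ler0c -(rmorph1 (real_complex R)) ltcR => s0 t0 t1.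
exists (expR (s / (1 - t)))%:C%C; first by rewrite ler0c expR_ge0.
move=> n; under eq_bigr => k _ do rewrite -rmorphXn -rmorphM -rmorphD.
rewrite -rmorph_prod lecR.
apply: (@le_trans _ _ (\prod_(k < n) expR (s * t ^+ k))).
  by apply: ler_prod => k _; rewrite expR_ge1Dx addr_ge0 // mulr_ge0 // exprn_ge0.
rewrite -expR_sum ler_expR -mulr_sumr ler_wpM2l //.
exact: sum_geometric_le.
Qed.

Lemma qpoch_bounded a p : `|p| < 1 ->
  exists2 B : C, 0 <= B & forall n, `|qpoch a p n| <= B.
Proof.
move=> p1; have [B B0 hB] := prod_bounded (normr_ge0 a) (normr_ge0 p) p1.
by exists B => // n; apply: le_trans (hB n); exact: norm_qpoch_le.
Qed.

Lemma qpochV_bounded p : `|p| < 1 ->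
  exists2 B : C, 0 <= B & forall n, `|(qpoch p p n)^-1| <= B.
Proof.
move=> p1.
have h : 0 <= `|p| / (1 - `|p|) by rewrite divr_ge0 // subr_ge0 ltW.
have [B B0 hB] := prod_bounded h (normr_ge0 p) p1.
by exists B => // n; apply: le_trans (hB n); exact: norm_qpochV_le.
Qed.

Lemma dominated_geometric (x : nat -> C) (D r : C) : 0 <= D -> 0 <= r -> r < 1 ->
  (forall n, `|x n| <= D * r ^+ n) -> dominated x.
Proof.
move=> D0 r0 r1 xD; apply: (@dominated_exhaust _ _ _ (fun B => iota 0 B) (D * (1 - r)^-1)).
- by move=> B; exact: iota_uniq.
- by move=> n; exists n.+1 => B nB; rewrite mem_iota.
move=> B; apply: (@le_trans _ _ (\sum_(i <- iota 0 B) D * r ^+ i)).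
  by apply: ler_sum => i _; exact: xD.
rewrite -mulr_sumr ler_wpM2l //.
have := sum_geometric_le B r0 r1.
by rewrite -(big_mkord xpredT (fun k => r ^+ k)) /index_iota subn0.
Qed.

(** The increments are bounded by a geometric sequence, and [(a; p)_M - 1] is their sum weighted by
    the indicator of [i < M], so the convergence is an instance of [dominated_tannery]. *)
Lemma qpoch_cvg a p : `|p| < 1 -> qpoch a p n @[n --> \oo] --> qpoch_inf a p.
Proof.
move=> p1; have [B B0 hB] := qpoch_bounded a p1.
pose d k : C := qpoch a p k.+1 - qpoch a p k.
have dd : dominated d.
  apply: (@dominated_geometric _ (B * `|a|) `|p|) => //; first exact: mulr_ge0.
  move=> n; rewrite /d qpochS mulrBr mulr1 addrAC subrr add0r normrN !normrM normrX mulrA.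
  apply: ler_wpM2r; first exact: exprn_ge0.
  by apply: ler_wpM2r; [exact: normr_ge0|exact: hB].
have H : (qpoch a p M - 1) @[M --> \oo] --> sum d * 1.
  apply: (@dominated_tannery _ _ d (fun M i => (i < M)%N%:R) 1 1 (fun M => iota 0 M)) => //.
  - by move=> M i; case: (i < M)%N; rewrite ?normr1 ?normr0.
  - move=> i; apply: (@cvg_eventually _ (fun=> 1) _ _ i.+1); last exact: cvg_cst.
    by move=> M ->.
  - by move=> M; exact: iota_uniq.
  - by move=> M i; rewrite mem_iota add0n /= => /negbTE ->; rewrite mulr0.
  move=> M; have -> : qpoch a p M - 1 = \sum_(0 <= k < M) d k by rewrite telescope_sumr // qpoch0.
  rewrite /index_iota subn0 big_seq [RHS]big_seq; apply: eq_bigr => i; rewrite mem_iota /= add0n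
      => ->.
  by rewrite mulr1.
exact: (cvgP _ (cvg_addr_const H)).
Qed.

(** If the limit were 0, some [(p; p)_N] would have norm at most [1 / (B + 1)] while its inverse has
    norm at most [B], giving [1 <= B / (B + 1)]. *)
Lemma qpoch_inf_neq0 p : `|p| < 1 -> qpoch_inf p p != 0.
Proof.
move=> p1; have [B B0 hB] := qpochV_bounded p1; apply/eqP => l0.
have := @qpoch_cvg p p p1; rewrite l0 => /cvgrPdist_le.
have B1 : 0 < (B + 1)^-1 by rewrite invr_gt0 ltr_wpDl.
move=> /(_ _ B1)[N _ /(_ N (leqnn N))] /=; rewrite sub0r normrN => h.
have := ler_pM (normr_ge0 _) (normr_ge0 _) h (hB N).
rewrite -normrM mulfV ?qpoch_neq0 // normr1 mulrC ler_pdivlMr ?ltr_wpDl // mul1r.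
by rewrite -subr_ge0 opprD addrA subrr add0r oppr_ge0 ler10.
Qed.

Lemma qpochV_cvg p : `|p| < 1 -> (qpoch p p n)^-1 @[n --> \oo] --> (qpoch_inf p p)^-1.
Proof. by move=> p1; apply: cvgV; [exact: qpoch_inf_neq0|exact: qpoch_cvg]. Qed.

End QPochhammerLimit.

Lemma theta_exp_ge f j : (absz j <= theta_exp f j)%N.
Proof.
have := theta_expE f j; have [j0|j0] : 0 <= j \/ j <= -1 by lia.
all: nia.
Qed.

Lemma theta_termE (K : numFieldType) f (q : K) j : theta_term f q j = q ^+ theta_exp f j.
Proof.
by rewrite /theta_term [RHS]exprnP; congr (_ ^ _); rewrite theta_expE expr2.
Qed.

Lemma tailsum0 f (s : f.-tuple nat) : tailsum s 0 = sumn s.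
Proof. by rewrite /tailsum sumnE [RHS](big_nth 0%N) size_tuple. Qed.

Lemma leq_sumn (s : seq nat) n : n \in s -> (n <= sumn s)%N.
Proof.
elim: s => //= m s IH; rewrite inE => /orP[/eqP ->|/IH]; [exact: leq_addr|lia].
Qed.

Lemma invP_inv_qpoch (K : numFieldType) (p : K) M N :
  invP p M N = inv_qpoch p p (M%:Z - N%:Z).
Proof.
have [NM|MN] := leqP N M.
  by have -> : M%:Z - N%:Z = (M - N)%N%:Z by [lia]; rewrite invPE.
rewrite invP_small //; case E : (M%:Z - N%:Z) => [a|a] //; lia.
Qed.

Section NormBounds.
Variable (K : numFieldType) (q : K).
Local Notation p := (q ^+ 3).
Local Notation P := (qpoch p p).

Lemma normM_le (a b x y : K) : `|a| <= x -> `|b| <= y -> `|a * b| <= x * y.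
Proof. by move=> ax bY; rewrite normrM ler_pM. Qed.

Lemma sum_tuple_box_geometric (r : K) B f :
  \sum_(s <- tuple_box B f) r ^+ tailsum s 0 = (\sum_(k < B) r ^+ k) ^+ f.
Proof.
elim: f => [|f IH].
  by rewrite big_seq1 expr0 /tailsum big_geq.
rewrite sum_tuple_box exprS -IH mulr_suml; apply: eq_bigr => n _.
by rewrite mulr_sumr; apply: eq_bigr => s _; rewrite tailsum_cons0 exprD.
Qed.

(** Of the quadratic exponent only the lower bound [m + n + N_1] is kept, which makes the bound a
    product of geometric terms; the other factors are bounded by constants. *)
Lemma norm_multisum_term_le (b1 b2 b3 : K) f m n (s : f.+1.-tuple nat) :
  `|q| < 1 -> (forall k, `|P k| <= b1) -> (forall k, `|(P k)^-1| <= b2) ->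
  (forall k, `|(qpoch q q k)^-1| <= b3) ->
  `|multisum_term q (m, n, s)| <=
    (1 + 1) * b2 ^+ f * (b1 * b2) * (b3 * b2 * b2) * (`|q| ^+ m * `|q| ^+ n * `|q| ^+ tailsum s
        0).
Proof.
move=> q1 h1 h2 h3.
have b20 : 0 <= b2 by apply: le_trans (h2 0%N).
rewrite multisum_termE /chain_weight /capparelli_term.
set e1 := (\sum_(i < f.+1) tailsum s i ^ 2 + \sum_(i < f.+1) tailsum s i)%N.
set e2 := (2 * m ^ 2 + 6 * m * n + 6 * n ^ 2 + m + 3 * n)%N.
set N := nth 0%N s f.
have -> : p ^+ e1 / (\prod_(i < f) P (nth 0%N s i)) * (P N / P (2 * N).+1%N *
    (q ^+ e2 * (1 + q ^+ (1 + 2 * m + 3 * n)) / (qpoch q q m * P n) * invP p N (m + 2 * n))) =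
  (1 + q ^+ (1 + 2 * m + 3 * n)) * (\prod_(i < f) (P (nth 0%N s i))^-1) * (P N * (P (2 *
      N).+1%N)^-1) *
   ((qpoch q q m)^-1 * (P n)^-1 * invP p N (m + 2 * n)) * q ^+ (3 * e1 + e2).
  by rewrite (exprD q (3 * e1)) (exprM q 3) prodfV !invfM; ring.
apply: normM_le; last first.
  rewrite normrX -!exprD ler_wiXn2l // ?ltW //.
  have : (tailsum s 0 <= e1)%N by rewrite /e1 [X in (_ + X)%N]big_ord_recl /=; lia.
  rewrite /e2; lia.
apply: normM_le; last first.
  apply: normM_le; first exact: normM_le.
  by rewrite /invP; case: ifP => _; rewrite ?normr0.
apply: normM_le; last exact: normM_le.
apply: normM_le.
  by rewrite (le_trans (ler_normD _ _)) // normr1 lerD2l normrX exprn_ile1 // ltW.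
rewrite normr_prod -[X in b2 ^+ X]card_ord -prodr_const; apply: ler_prod => i _.
by rewrite normr_ge0 h2.
Qed.

Lemma norm_inv_qpoch_le (a : K) b : 0 <= b -> (forall k, `|(qpoch a a k)^-1| <= b) ->
  forall j, `|inv_qpoch a a j| <= b.
Proof. by move=> b0 h [k|k] /=; rewrite ?normr0. Qed.

Lemma inv_qpoch_cvg (a l : K) j : (qpoch a a n)^-1 @[n --> \oo] --> l ->
  inv_qpoch a a (M%:Z + j) @[M --> \oo] --> l.
Proof.
move=> h.
have := @cvg_comp_oo _ (fun n => (qpoch a a n)^-1) l (fun M => absz (M%:Z + j)) _ h.
have hphi A : exists M0, forall M, (M0 <= M)%N -> (A <= absz (M%:Z + j)%R)%N.
  by exists (A + absz j)%N => M; lia.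
move=> /(_ hphi); apply: (@cvg_eventually _ _ _ _ (absz j)) => M jM.
by have -> : M%:Z + j = (absz (M%:Z + j))%:Z by lia.
Qed.

End NormBounds.

(** * Passage to the limit and the two equalities *)

Section Assembly.
Variables (R : realType) (q : (R[i] : numFieldType)).
Local Notation C := (R[i] : numFieldType).
Hypothesis q1 : `|q| < 1.

Lemma normX_lt1 k : `|q ^+ k.+1| < 1.
Proof. by rewrite normrX exprn_ilt1. Qed.

Lemma dominated_theta f : dominated (theta_term f q).
Proof.
pose E B := map Posz (iota 0 B) ++ map Negz (iota 0 B).
have hx j : `|theta_term f q j| <= `|q| ^+ absz j.
  by rewrite theta_termE normrX ler_wiXn2l ?normr_ge0 ?theta_exp_ge // ltW.
apply: (@dominated_exhaust _ _ _ E ((1 - `|q|)^-1 + (1 - `|q|)^-1)).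
- move=> B; rewrite cat_uniq !map_inj_uniq ?iota_uniq; [|by move=> ? ? []|by move=> ? ? []].
  by rewrite andbT; apply/hasPn => _ /mapP[n _ ->]; apply/negP => /mapP[].
- move=> j; exists (absz j).+1 => B jB; rewrite mem_cat; case: j jB => n nB.
    by rewrite map_f // mem_iota.
  by rewrite [X in _ || X]map_f ?orbT // mem_iota /= add0n (leq_trans _ nB).
move=> B; rewrite big_cat !big_map /=.
have S : \sum_(k <- iota 0 B) `|q| ^+ k <= (1 - `|q|)^-1.
  have := sum_geometric_le B (normr_ge0 q) q1.
  by rewrite -(big_mkord xpredT (fun k => `|q| ^+ k)) /index_iota subn0.
apply: lerD; apply: le_trans S; apply: ler_sum => n _; first exact: hx.
apply: le_trans (hx _) _; by rewrite ler_wiXn2l ?normr_ge0 ?leqnSn // ltW.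
Qed.

Definition index_box B f : seq (nat * nat * f.-tuple nat) :=
  [seq (mn, s) | mn <- [seq (m, n) | m <- iota 0 B, n <- iota 0 B], s <- tuple_box B f].

Lemma uniq_index_box B f : uniq (index_box B f).
Proof.
apply: allpairs_uniq => [||[? ?] [? ?] _ _ //]; last exact: uniq_tuple_box.
by apply: allpairs_uniq => [||[? ?] [? ?] _ _ //]; exact: iota_uniq.
Qed.

Lemma mem_index_box B f m n (s : f.-tuple nat) :
  (m < B)%N -> (n < B)%N -> all (fun k => (k < B)%N) s -> (m, n, s) \in index_box B f.
Proof.
move=> mB nB sB; apply: allpairs_f; last by rewrite mem_tuple_box.
by apply: allpairs_f; rewrite mem_iota.
Qed.

Lemma sum_index_box (V : nmodType) B f (F : nat * nat * f.-tuple nat -> V) :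
  \sum_(t <- index_box B f) F t =
  \sum_(m < B) \sum_(n < B) \sum_(s <- tuple_box B f) F (nat_of_ord m, nat_of_ord n, s).
Proof.
rewrite big_allpairs_dep big_allpairs_dep -{1}(subn0 B) -/(index_iota 0 B) big_mkord.
apply: eq_bigr => m _; rewrite -{1}(subn0 B) -/(index_iota 0 B) big_mkord.
by apply: eq_bigr => n _.
Qed.

Lemma dominated_multisum f : dominated (@multisum_term _ f.+1 q).
Proof.
have [b1 b10 h1] := qpoch_bounded (q ^+ 3) (normX_lt1 2).
have [b2 b20 h2] := qpochV_bounded (normX_lt1 2).
have [b3 b30 h3] := qpochV_bounded q1.
pose D := (1 + 1) * b2 ^+ f * (b1 * b2) * (b3 * b2 * b2).
have D0 : 0 <= D by rewrite /D !mulr_ge0 // ?exprn_ge0 // addr_ge0.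
pose g := (1 - `|q|)^-1.
apply: (@dominated_exhaust _ _ _ (fun B => index_box B f.+1) (D * (g * (g * g ^+ f.+1)))).
- by move=> B; exact: uniq_index_box.
- move=> [[m n] s]; exists (m + n + sumn s).+1%N => B hB.
  apply: mem_index_box; [lia|lia|].
  apply/allP => k /leq_sumn ks; apply: leq_ltn_trans ks _; apply: leq_trans hB.
  exact: leq_addl.
move=> B; rewrite sum_index_box.
pose G := \sum_(k < B) `|q| ^+ k.
have G0 : 0 <= G by apply: sumr_ge0 => k _; rewrite exprn_ge0.
have Gg : G <= g by exact: sum_geometric_le.
apply: (@le_trans _ _ (D * (G * (G * G ^+ f.+1)))); last first.
  by rewrite ler_wpM2l // !ler_pM ?mulr_ge0 ?exprn_ge0 // lerXn2r // ?nnegrE (le_trans G0).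
rewrite {1}/G mulr_suml mulr_sumr; apply: ler_sum => m _.
rewrite {1}/G mulr_suml 2!mulr_sumr; apply: ler_sum => n _.
rewrite -sum_tuple_box_geometric 3!mulr_sumr; apply: ler_sum => s _.
have := norm_multisum_term_le m n s q1 h1 h2 h3.
by rewrite -/D !mulrA.
Qed.

Local Notation p := (q ^+ 3).

Lemma bailey_beta_cvg f :
  bailey_beta q f M @[M --> \oo] --> sum (theta_term f q) * ((qpoch_inf p p)^-1 * (qpoch_inf p
      p)^-1).
Proof.
have [b b0 hb] := qpochV_bounded (normX_lt1 2).
(* With [j = n - M - 1] these are the factors [1 / P n] and [1 / P (2 M + 1 - n)]. Each tends to
   [1 / (p; p)_oo], and the zero convention of [inv_qpoch] confines [w M] to [-M-1 <= j <= M]. *)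
pose w (M : nat) (j : int) : C := inv_qpoch p p (M%:Z + (1 + j)) * inv_qpoch p p (M%:Z + - j).
pose E (M : nat) := [seq n%:Z - M.+1%:Z | n <- iota 0 (2 * M).+2].
apply: (@dominated_tannery _ _ _ w (b * b) _ E).
- exact: dominated_theta.
- exact: mulr_ge0.
- by move=> M j; apply: normM_le; exact: norm_inv_qpoch_le.
- move=> j; apply: cvgM; apply: inv_qpoch_cvg; exact: qpochV_cvg (normX_lt1 2).
- by move=> M; rewrite map_inj_uniq ?iota_uniq // => a b'; lia.
- move=> M j jE.
  have [h|h] : (M%:Z + (1 + j) < 0) \/ (M%:Z + - j < 0).
    case: (ltP (M%:Z + (1 + j)) 0) => [?|h1]; first by left.
    case: (ltP (M%:Z + - j) 0) => [?|h2]; first by right.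
    case/negP: jE; apply/mapP; exists (absz (M%:Z + (1 + j))); last lia.
    by rewrite mem_iota; lia.
  + by rewrite /w; case: (M%:Z + (1 + j)) h => // k _; rewrite mul0r mulr0.
  + by rewrite /w; case: (M%:Z + - j) h => // k _; rewrite !mulr0.
move=> M; rewrite big_map /bailey_beta -(big_mkord xpredT (fun n => q ^+ theta_exp f (n%:Z -
    M.+1%:Z) *
   ((qpoch p p n)^-1 * invP p (2 * M).+1%N n))) /index_iota subn0.
apply: eq_bigr => n _; rewrite theta_termE /w invP_inv_qpoch.
have -> : M%:Z + (1 + (n%:Z - M.+1%:Z)) = n%:Z by lia.
by have -> : M%:Z + - (n%:Z - M.+1%:Z) = (2 * M).+1%N%:Z - n%:Z by lia.
Qed.

Lemma multisum_cvg f :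
  bailey_beta q f.+1 M @[M --> \oo] --> sum (@multisum_term _ f.+1 q) * (qpoch_inf p p)^-1.
Proof.
have [b b0 hb] := qpochV_bounded (normX_lt1 2).
have P0 n := qpoch_neq0 n (normX_lt1 2).
have Q0 n := qpoch_neq0 n q1.
pose w (M : nat) (t : nat * nat * f.+1.-tuple nat) : C := invP p M (tailsum t.2 0).
apply: (@dominated_tannery _ _ _ w b _ (fun M => index_box M.+2 f.+1)).
- exact: dominated_multisum.
- by [].
- by move=> M t; rewrite /w invP_inv_qpoch; exact: norm_inv_qpoch_le.
- move=> t; rewrite /w; under eq_fun do rewrite invP_inv_qpoch.
  by apply: inv_qpoch_cvg; exact: qpochV_cvg (normX_lt1 2).
- by move=> M; exact: uniq_index_box.
- move=> M [[m n] s] tE; rewrite /w [(_, _).2]/=.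
  (* Outside the box either [N_1 > M], killed by the weight, or [m + 2 n > n_f], killed by the
     summand; otherwise all indices are at most [M]. *)
  have [MT|TM] := ltnP M (tailsum s 0); first by rewrite invP_small ?mulr0.
  rewrite tailsum0 in TM *.
  have [hN|hN] := ltnP (nth 0%N s f) (m + 2 * n)%N.
    by rewrite multisum_termE /chain_weight /capparelli_term (invP_small _ hN) !(mulr0, mul0r).
  have hf : (nth 0%N s f <= M)%N.
    by apply: leq_trans TM; apply: leq_sumn; rewrite mem_nth // size_tuple.
  case/negP: tE; apply: mem_index_box; [lia|lia|].
  by apply/allP => k /leq_sumn ks; apply: leq_ltn_trans ks _; apply: leq_ltn_trans TM _.
move=> M; rewrite sum_index_box.
by rewrite -(@multisum_finite _ q P0 Q0 f M M.+2).
Qed.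

(** Two limits of the same sequence: the multisum carries one factor [1 / (p; p)_oo] and the theta
    sum two, so one cancels. *)
Lemma multisum_eq_theta f :
  sum (@multisum_term _ f.+1 q) = (qpoch_inf p p)^-1 * sum (theta_term f.+1 q).
Proof.
have l0 : (qpoch_inf p p)^-1 != 0 by rewrite invr_eq0 qpoch_inf_neq0 // normX_lt1.
apply: (mulIf l0).
rewrite (cvg_seq_unique (@multisum_cvg f) (@bailey_beta_cvg f.+1)).
by rewrite mulrA; congr (_ * _); exact: mulrC.
Qed.

(** Division by [(x; x)_(2M)] turns the binomial into [1 / ((x; x)_(M+j) (x; x)_(M-j))], a bounded
    weight. *)
Lemma finite_theta_cvg f (x := q ^+ (6 * f + 6)) :
  finite_theta q f M M / qpoch x x (M + M) @[M --> \oo] -->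
  sum (theta_term f q) * ((qpoch_inf x x)^-1 * (qpoch_inf x x)^-1).
Proof.
have x1 : `|x| < 1 by rewrite /x addnS normX_lt1.
have X0 n := qpoch_neq0 n x1.
have [b b0 hb] := qpochV_bounded x1.
pose w (M : nat) (j : int) : C := inv_qpoch x x (M%:Z + j) * inv_qpoch x x (M%:Z + - j).
pose E (M : nat) := [seq n%:Z - M%:Z | n <- iota 0 (M + M).+1].
apply: (@dominated_tannery _ _ _ w (b * b) _ E).
- exact: dominated_theta.
- exact: mulr_ge0.
- by move=> M j; apply: normM_le; exact: norm_inv_qpoch_le.
- move=> j; apply: cvgM; apply: inv_qpoch_cvg; exact: qpochV_cvg x1.
- by move=> M; rewrite map_inj_uniq ?iota_uniq // => a b'; lia.
- move=> M j jE.
  have [h|h] : (M%:Z + j < 0) \/ (M%:Z + - j < 0).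
    case: (ltP (M%:Z + j) 0) => [?|h1]; first by left.
    case: (ltP (M%:Z + - j) 0) => [?|h2]; first by right.
    case/negP: jE; apply/mapP; exists (absz (M%:Z + j)); last lia.
    by rewrite mem_iota; lia.
  + by rewrite /w; case: (M%:Z + j) h => // k _; rewrite mul0r mulr0.
  + by rewrite /w; case: (M%:Z + - j) h => // k _; rewrite !mulr0.
move=> M; rewrite big_map /finite_theta -(big_mkord xpredT (fun n => q ^+ theta_exp f (n%:Z -
    M%:Z) *
   gbin x (M + M) n)) /index_iota subn0 mulr_suml.
apply: eq_bigr => n _; rewrite theta_termE /w gbin_invP // invP_inv_qpoch.
have -> : M%:Z + (n%:Z - M%:Z) = n%:Z by lia.
have -> : M%:Z + - (n%:Z - M%:Z) = (M + M)%N%:Z - n%:Z by lia.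
by rewrite -[LHS]mulrA; congr (_ * _); rewrite mulrC mulKf.
Qed.

(** Comparing the limits of the sum and product sides of the finite identity, one [1 / (x; x)_oo]
    cancels and the other becomes the first factor of the product. *)
Lemma triple_product f (x := q ^+ (6 * f + 6)) :
  sum (theta_term f q) = qpochs_inf [:: x; - q; - q ^+ (6 * f + 5)] x.
Proof.
have x1 : `|x| < 1 by rewrite /x addnS normX_lt1.
have X0 n := qpoch_neq0 n x1.
have l0 := qpoch_inf_neq0 x1.
have H : finite_theta q f M M / qpoch x x (M + M) @[M --> \oo] -->
    qpoch_inf (- q) x * qpoch_inf (- q ^+ (6 * f + 5)) x * (qpoch_inf x x)^-1.
  under eq_fun do rewrite finite_triple_product //.
  apply: cvgM; first by apply: cvgM; exact: qpoch_cvg.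
  apply: (@cvg_comp_oo _ (fun n => (qpoch x x n)^-1) _ (fun M => M + M)%N); last exact:
      qpochV_cvg.
  by move=> A; exists A => M; lia.
have := cvg_seq_unique (@finite_theta_cvg f) H; rewrite -/x mulrA.
move=> /(mulIf (invr_neq0 l0)) /(congr1 ( *%R^~ (qpoch_inf x x))); rewrite divfK // => ->.
by rewrite /qpochs_inf !big_cons big_nil mulr1 mulrC mulrA.
Qed.

End Assembly.

Theorem theorem18 (R : realType) (f : nat) (q : R[i])
    (hf : (0 < f)%N) (hq : `|q| < 1) :
  [/\ uncond_cvg (@multisum_term _ f q),
      uncond_cvg (theta_term f q),
      sum (@multisum_term _ f q)
        = (qpoch_inf (q ^+ 3) (q ^+ 3))^-1 * sum (theta_term f q)
    & (qpoch_inf (q ^+ 3) (q ^+ 3))^-1 * sum (theta_term f q)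
        = qpochs_inf [:: q ^+ (6 * f + 6); - q; - q ^+ (6 * f + 5)]
            (q ^+ (6 * f + 6))
          / qpoch_inf (q ^+ 3) (q ^+ 3)].
Proof.
case: f hf => // f _; split.
- exact: dominated_cvg (dominated_multisum hq f).
- exact: dominated_cvg (dominated_theta hq f.+1).
- exact: multisum_eq_theta.
- by rewrite mulrC; congr (_ * _); exact: triple_product.
Qed.
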